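(* Let $\mathbf{\Sigma}$ be an $m\times m$ positive semidefinite matrix whose diagonal entries are all $1$, let $(X_1,\dots,X_m)\sim\mathcal{N}(\mathbf{0},\mathbf{\Sigma})$, and let $p_1,\dots,p_m\in[1,\infty]$. Then $(X_1,\dots,X_m)$ is $(p_1,\dots,p_m)$-hypercontractive, i.e. $$\mathbb{E}\left[\prod_{j=1}^m f_j(X_j)\right]\le\prod_{j=1}^m\|f_j(X_j)\|_{p_j}\qquad\text{for all bounded measurable }f_1,\dots,f_m\colon\mathbb{R}\to\mathbb{R},$$ if and only if $$\mathbf{P}\succcurlyeq\mathbf{\Sigma},$$ that is, $\mathbf{P}-\mathbf{\Sigma}$ is positive semidefinite, where $\mathbf{P}$ is the diagonal matrix with $p_1,\dots,p_m$ on its diagonal.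
   Context: $\|f_j(X_j)\|_{p_j}=(\mathbb{E}|f_j(X_j)|^{p_j})^{1/p_j}$ for $p_j<\infty$, and the essential supremum of $|f_j(X_j)|$ for $p_j=\infty$. If some $p_j=\infty$, the condition $\mathbf{P}\succcurlyeq\mathbf{\Sigma}$ is understood as $\sum_jp_jv_j^2\ge v^\top\mathbf{\Sigma}v$ for all $v\in\mathbb{R}^m$ with the convention $\infty\cdot0=0$ (equivalently, the submatrix of $\mathbf{P}-\mathbf{\Sigma}$ indexed by the finite $p_j$ is positive semidefinite). *)

(* Defs.v *)
From HB Require Import structures.
From mathcomp Require Import all_boot all_order all_algebra.
From mathcomp Require Import all_classical all_reals all_analysis.

Set Implicit Arguments.
Unset Strict Implicit.
Unset Printing Implicit Defensive.

Import Order.TTheory GRing.Theory Num.Theory.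
Import numFieldNormedType.Exports.

Local Open Scope classical_set_scope.
Local Open Scope ring_scope.

Definition psdmx (R : realType) (n : nat) (A : 'M[R]_n) : Prop :=
  A^T = A /\ forall v : 'cV[R]_n, 0 <= (v^T *m A *m v) 0 0.

(* [P >= S] in the Loewner order for P the diagonal matrix of entries [p j],
   possibly infinite: +oo * 0 = 0 in \bar R.  [diag_dominates_psdmx] below is
   the case where all [p j] are finite. *)
Definition diag_dominates (R : realType) (m : nat)
    (p : 'I_m -> \bar R) (S : 'M[R]_m) : Prop :=
  forall v : 'cV[R]_m,
    (((v^T *m S *m v) 0 0)%:E <= \sum_(j < m) p j * ((v j 0) ^+ 2)%:E)%E.

Lemma diag_dominates_psdmx (R : realType) (m : nat) (r : 'rV[R]_m)
    (S : 'M[R]_m) : S^T = S ->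
  diag_dominates (fun j => (r 0 j)%:E) S <-> psdmx (diag_mx r - S).
Proof.
move=> symS.
have E (v : 'cV[R]_m) : (v^T *m (diag_mx r - S) *m v) 0 0 =
    \sum_(j < m) r 0 j * v j 0 ^+ 2 - (v^T *m S *m v) 0 0.
  rewrite mulmxBr mulmxBl [LHS]mxE; congr (_ + _); last by rewrite mxE.
  rewrite mxE; apply: eq_bigr => j _; rewrite mul_mx_diag !mxE.
  by rewrite mulrAC [RHS]mulrC.
have F (v : 'cV[R]_m) : (\sum_(j < m) (r 0 j)%:E * (v j 0 ^+ 2)%:E)%E =
    (\sum_(j < m) r 0 j * v j 0 ^+ 2)%:E.
  by rewrite -sumEFin; apply: eq_bigr => j _; rewrite EFinM.
split=> [H|[_ H] v].
- split=> [|v]; first by rewrite linearB /= tr_diag_mx symS.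
  by rewrite E subr_ge0 -lee_fin -F; exact: H.
- by rewrite F lee_fin -subr_ge0 -E; exact: H.
Qed.

Section standard_gaussian.
Context {R : realType}.

(* [normal_prob] lives on [measurableTypeR R], which has the same measurable
   sets as the canonical structure of [R] but another display. *)
Definition cons_tup (n : nat) (z : measurableTypeR R * n.-tuple R) :
    n.+1.-tuple R :=
  [tuple of (z.1 : R) :: z.2].

Lemma measurable_cons_tup (n : nat) :
  measurable_fun [set: measurableTypeR R * n.-tuple R] (@cons_tup n).
Proof.
apply: (@measurable_cons _ _ _ _ (fun z => z.1 : R) n snd) => //.
by move=> _ Y mY; exact: (@measurable_fst _ _ (measurableTypeR R)).
Qed.

HB.instance Definition _ (n : nat) :=
  isMeasurableFun.Build _ _ _ _ (@cons_tup n) (@measurable_cons_tup n).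

(* The law of k independent standard normal variables: the k-fold product of
   [normal_prob 0 1]. *)
Fixpoint std_gaussian (k : nat) : probability (k.-tuple R) R :=
  match k with
  | 0%N => \d_([tuple] : 0.-tuple R)
  | k.+1 => distribution (normal_prob (0 : R) 1 \x std_gaussian k)%E
              (@cons_tup k)
  end.

Lemma std_gaussian_rectangle (k : nat) (B : 'I_k -> set R) :
  (forall i, measurable (B i)) ->
  std_gaussian k [set z | forall i, B i (tnth z i)] =
  (\prod_(i < k) normal_prob 0 1 (B i))%E.
Proof.
elim: k B => [|k IH] B mB.
  rewrite big_ord0 /= diracE mem_set//=; by case.
rewrite big_ord_recl -IH //= /distribution /pushforward.
rewrite (_ : _ @^-1` _ = B ord0 `*`
    [set z : k.-tuple R | forall i, B (lift ord0 i) (tnth z i)]); last first.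
  apply/seteqP; split => -[x z] /=.
    move=> H; split=> [|i]; first exact: (H ord0).
    by have := H (lift ord0 i); rewrite tnthS.
  by case=> Bx Bz i; case: (unliftP ord0 i) => [j|] ->; rewrite ?tnthS.
rewrite product_measure1E//; first exact: (mB ord0).
rewrite (_ : [set _ | _] =
    \bigcap_i ((@tnth _ R)^~ i @^-1` (B (lift ord0 i)))); last first.
  by apply/seteqP; split => z /= H i; [move=> _; exact: H|exact: (H i I)].
apply: fin_bigcap_measurable => // i _; rewrite -[X in measurable X]setTI.
exact: measurable_tnth.
Qed.

End standard_gaussian.

(* X ~ N(0, S): X has the law of A Z, where Z is a standard Gaussian vector of
   some dimension k and A A^T = S; S may be singular.  Laws are compared as
   Borel measures on R^m. *)
Definition centered_gaussian (R : realType) (m : nat) (d : measure_display)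
    (T : measurableType d) (P : probability T R) (X : 'I_m -> {RV P >-> R})
    (S : 'M[R]_m) : Prop :=
  exists (k : nat) (A : 'M[R]_(m, k)), A *m A^T = S /\
    forall B : set (m.-tuple R), measurable B ->
      P [set w | B [tuple X j w | j < m]] =
      std_gaussian k
        [set z | B [tuple \sum_(l < k) A j l * tnth z l | j < m]].

Definition hypercontractive (R : realType) (m : nat) (d : measure_display)
    (T : measurableType d) (P : probability T R) (X : 'I_m -> {RV P >-> R})
    (p : 'I_m -> \bar R) : Prop :=
  forall f : 'I_m -> R -> R,
    (forall j, measurable_fun [set: R] (f j)) ->
    (forall j, bounded_fun (f j : R -> R^o)) ->
    ('E_P[(fun w => \prod_(j < m) f j (X j w))%R]
       <= \prod_(j < m) 'N[P]_(p j)[EFin \o (f j \o X j)])%E.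

(* Main.v *)
(* Sufficiency is a heat-flow argument.  Write X = A Z with Z standard Gaussian
   and rows A_j of norm 1, c_j = 1 / p_j (0 if p_j = +oo) and P_s for the
   Gaussian average [heat]; for g_j bounded between two positive constants put
     flow s t = E prod_j (P_s g_j)(t A_j.Z) ^ c_j,   s^2 + t^2 = 1,
   which goes from prod_j (E g_j) ^ c_j at s = 1 to the expectation of interest
   at s = 0.  Moving an amount h = a^2 of variance from s to t changes
   ln prod_j (P_s g_j) ^ c_j by a drift of
     h / 2 * (|sum_j c_j beta_j A_j|^2 - sum_j c_j beta_j^2)
   with beta_j the logarithmic derivative of P_s g_j; P >= Sigma says, with
   v_j = c_j beta_j, that this is nonpositive.  No stochastic calculus is needed:
   on [e, 1] the functions P_s g_j have uniformly bounded second-order Taylor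
   remainders, so each of the n steps costs O(h^(3/2)), a total of O(n^(-1/2)).
   Then e -> 0 for continuous g_j, and L^1 approximation gives measurable g_j.
   The norm inequality is the case g_j = (|f_j| + delta) ^ p_j, delta -> 0.

   Necessity is tested on the (truncated) exponentials f_j(x) = exp(v_j x),
   for which the inequality reads
   exp(v^T Sigma v / 2) <= exp(sum_j p_j v_j^2 / 2). *)
Require Import Defs.
From HB Require Import structures.
From mathcomp Require Import all_boot all_order all_algebra.
From mathcomp Require Import all_classical all_reals all_analysis.
From mathcomp Require Import measurable_realfun ess_sup_inf ring lra.

Set Implicit Arguments.
Unset Strict Implicit.
Unset Printing Implicit Defensive.

Import Order.TTheory GRing.Theory Num.Theory.
Import numFieldNormedType.Exports.

Local Open Scope classical_set_scope.
Local Open Scope ring_scope.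

(** * Gaussian integrals *)

(** The obstacle is uniformity: the error of one step must be bounded independently of the starting
    point, of the step and of the functions, since [n] such errors are added. Three choices secure
    this. Increments are measured as [q / u - 1] with [u] the Gaussian mean of [q], so the
    first-order term integrates to exactly zero. A shift of the argument of [P_s g] is moved onto
    the Gaussian density (Cameron-Martin), so a merely bounded measurable [g] gets a first-order
    expansion with quadratic remainder; its constant grows like [1 / e ^+ 2], hence the cut-off at
    [e]. Finally every remainder of a step is cubic in [a] times [1 + sum_j |A_j.z|], whose cube has
    a finite Gaussian integral. The two-sided positive bounds on [g_j] give bounded logarithms of
    quotients and Lipschitz products of powers. An index with [p_j = +oo] has [c_j = 0] and drops
    out of the flow; its essential supremum is extracted from the product before the flow inequality
    is applied. *)

Section lebesgue.
Context {R : realType}.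
Local Notation mu := (@lebesgue_measure R).
Implicit Types (f : R -> \bar R) (a b : R).

Definition affine a b (x : measurableTypeR R) : measurableTypeR R := a * x + b.

Lemma measurable_affine a b : measurable_fun [set: measurableTypeR R] (affine a b).
Proof.
have : measurable_fun [set: R] (fun x : R => a * x + b).
  by apply: measurable_funD => //; exact: measurable_funM.
by move=> h _ Y mY; apply: h.
Qed.

Lemma preimage_affine_ocitv a b (x y : R) : 0 < a ->
  affine a b @^-1` `]x, y]%classic = `](x - b) / a, (y - b) / a]%classic.
Proof.
move=> a0; apply/seteqP; split => z /=; rewrite !in_itv/= /affine.
  by rewrite ltr_pdivrMr // ler_pdivlMr // ltrBlDr lerBrDr ![z * a]mulrC.
by rewrite ltr_pdivrMr // ler_pdivlMr // ltrBlDr lerBrDr ![z * a]mulrC.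
Qed.

(** Uniqueness of Lebesgue measure: the rescaled pushforward along [affine a b] gives each half-open
    interval its length. *)
Lemma lebesgue_measure_affine a b (A : set (measurableTypeR R)) : 0 < a ->
  measurable A -> mu A = (a%:E * mu (affine a b @^-1` A))%E.
Proof.
move=> a0 mA; have maff := measurable_affine a b.
pose nu : {measure set (measurableTypeR R) -> \bar R} :=
  mscale (NngNum (ltW a0)) (pushforward mu (affine a b)).
apply: (@lebesgue_measure_unique _ (nu maff)) => // _ [[x y]] _ <-.
rewrite -[RHS]/(a%:E * mu (affine a b @^-1` `]x, y]))%E /= preimage_affine_ocitv //.
rewrite !lebesgue_measure_itv/=.
rewrite !lte_fin ltr_pM2r ?invr_gt0 // ltrD2r.
case: ifPn => _; last by rewrite mule0.
by rewrite -!EFinD -EFinM; congr EFin; field; rewrite gt_eqF.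
Qed.

Lemma ge0_integral_affine a b f : a != 0 -> measurable_fun [set: R] f ->
  (forall x, 0 <= f x)%E ->
  (\int[mu]_x f x = `|a|%:E * \int[mu]_x f (a * x + b)%R)%E.
Proof.
have pos a' b' g : 0 < a' -> measurable_fun [set: R] g ->
  (forall x, 0 <= g x)%E ->
  (\int[mu]_x g x = `|a'|%:E * \int[mu]_x g (a' * x + b')%R)%E.
  move=> a0 mg g0; have maff := measurable_affine a' b'.
  rewrite (eq_measure_integral
    (mscale (NngNum (ltW a0)) (pushforward mu (affine a' b')))).
    by rewrite ge0_integral_mscale //= ge0_integral_pushforward // gtr0_norm.
  by move=> A mA _; apply: lebesgue_measure_affine.
move=> a0 mf f0; have [ap|an] := ltP 0 a; first exact: pos.
have {}an : 0 < - a by rewrite oppr_gt0 lt_neqAle a0.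
(* A negative slope is the positive slope [- a] composed with the reflection, which preserves
   Lebesgue measure. *)
rewrite (eq_measure_integral (pushforward mu (-%R : _ -> measurableTypeR R))); last first.
  by move=> A mA _; apply/esym/lebesgue_measureN.
rewrite ge0_integral_pushforward //=.
rewrite (pos (- a) (- b)) //.
- rewrite normrN; congr (_ * _)%E; apply: eq_integral => x _.
  by congr (f _); ring.
- exact: measurableT_comp.
Qed.

Definition gauss_density (x : R) : R := normal_pdf 0 1 x.

Lemma gauss_densityE x :
  gauss_density x = (Num.sqrt (pi *+ 2))^-1 * expR (- (x ^+ 2) / 2).
Proof.
rewrite /gauss_density normal_pdfE ?oner_neq0 // /normal_peak /normal_fun.
by rewrite expr1n mul1r subr0.
Qed.

Lemma gauss_density_ge0 x : 0 <= gauss_density x.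
Proof. exact: normal_pdf_ge0. Qed.

Lemma measurable_gauss_density : measurable_fun [set: R] gauss_density.
Proof. exact: measurable_normal_pdf. Qed.

(* [gauss] moves [normal_prob 0 1] from [measurableTypeR R] to the canonical
   measurable structure of [R]. *)
Definition gauss_id (x : measurableTypeR R) : R := x.

Lemma measurable_gauss_id : measurable_fun [set: measurableTypeR R] gauss_id.
Proof. by move=> _ Y mY; rewrite setTI. Qed.

HB.instance Definition _ :=
  isMeasurableFun.Build _ _ _ _ gauss_id measurable_gauss_id.

Definition gauss : probability R R :=
  distribution (normal_prob (0 : R) 1) gauss_id.

(** Change of variables is available for the Radon-Nikodym derivative; that derivative agrees almost
    everywhere with [gauss_density], because both have the same integral over every measurable
    set. *)
Lemma ge0_integral_gauss f : measurable_fun [set: R] f ->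
  (forall x, 0 <= f x)%E ->
  (\int[gauss]_x f x = \int[mu]_x (f x * (gauss_density x)%:E))%E.
Proof.
move=> mf f0; rewrite /gauss ge0_integral_distribution //=.
have dom := @normal_prob_dominates R 0 1.
rewrite -(Radon_Nikodym_SigmaFinite.change_of_variables dom) //.
apply: ae_eq_integral => //.
- apply: emeasurable_funM => //; apply: (measurable_int mu).
  exact: Radon_Nikodym_SigmaFinite.f_integrable.
- apply: emeasurable_funM => //=; apply/measurable_EFinP.
  exact: measurable_gauss_density.
- apply: ae_eqe_mul2l => /=.
  apply: integral_ae_eq => //=.
  + exact: Radon_Nikodym_SigmaFinite.f_integrable.
  + by apply/measurable_EFinP; exact: measurable_gauss_density.
  + move=> E _ mE; rewrite -Radon_Nikodym_SigmaFinite.f_integral //.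
Qed.

Lemma measurable_fun_comp_affine a b f : measurable_fun [set: R] f ->
  measurable_fun [set: R] (fun x => f (a * x + b)%R).
Proof.
move=> mf; apply: (measurableT_comp mf).
by apply: measurable_funD => //; exact: measurable_funM.
Qed.

Lemma measurable_lin2 a b :
  measurable_fun [set: R * R] (fun z => a * z.1 + b * z.2).
Proof. by apply: measurable_funD; apply: measurable_funM => //. Qed.

Lemma integral_gauss_density a b : a != 0 ->
  (\int[mu]_x (gauss_density (a * x + b))%:E = `|a|^-1%:E)%E.
Proof.
move=> a0.
have : (\int[mu]_x (gauss_density x)%:E = 1)%E by exact: integral_normal_pdf.
rewrite (ge0_integral_affine b a0); last 2 first.
- by apply/measurable_EFinP; exact: measurable_gauss_density.
- by move=> x; rewrite lee_fin gauss_density_ge0.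
set I := integral _ _ _ => H.
have I0 : (0 <= I)%E by apply: integral_ge0 => x _; rewrite lee_fin gauss_density_ge0.
have na0 : 0 < `|a| by rewrite normr_gt0.
move: I I0 H => [r||] //=; last by rewrite gt0_muley.
rewrite lee_fin => r0 [] H; congr EFin.
by apply: (mulfI (lt0r_neq0 na0)); rewrite H divff // gt_eqF.
Qed.

(** Completing the square. Probabilistically, for [u = a x + b y] the joint density of [(x, u)] is
    the marginal density of [u], of variance [s ^+ 2], times the conditional density of [x] given
    [u], up to normalising factors. *)
Lemma gauss_densityM a b s u x : s ^+ 2 = a ^+ 2 + b ^+ 2 -> b != 0 -> s != 0 ->
  gauss_density (b^-1 * u + (- (a / b) * x)) * gauss_density x =
  gauss_density (s^-1 * u) * gauss_density (s / b * x + - (a / (s * b)) * u).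
Proof.
move=> sab b0 s0; rewrite !gauss_densityE mulrACA [RHS]mulrACA -!expRD.
congr (_ * expR _); rewrite -!mulrDl; congr (_ / _); rewrite -!opprD; congr (- _).
apply: (@mulIf _ (b ^+ 2 * s ^+ 2)); first by rewrite mulf_neq0 ?expf_neq0.
transitivity ((u - a * x) ^+ 2 * s ^+ 2 + x ^+ 2 * b ^+ 2 * s ^+ 2).
  by field.
transitivity (u ^+ 2 * b ^+ 2 + (s ^+ 2 * x - a * u) ^+ 2); last first.
  by field; rewrite ?s0 ?b0.
have -> : b ^+ 2 = s ^+ 2 - a ^+ 2 by rewrite sab addrAC subrr add0r.
by ring.
Qed.

(** The inner variable is changed to [u = a x + b y], which needs [b != 0]. After Tonelli,
    [gauss_densityM] isolates a Gaussian factor in [x] that integrates out. *)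
Lemma gauss_conv_neq0 a b s f : s ^+ 2 = a ^+ 2 + b ^+ 2 -> b != 0 ->
  measurable_fun [set: R] f -> (forall x, 0 <= f x)%E ->
  (\int[gauss]_x \int[gauss]_y f (a * x + b * y)%R = \int[gauss]_x f (s * x)%R)%E.
Proof.
move=> sab b0 mf f0.
have s0 : s != 0.
  apply: contra_eq_neq sab => ->; rewrite expr0n/= eq_sym gt_eqF //.
  by rewrite ltr_wpDl ?sqr_ge0 // exprn_even_gt0.
have mg := measurable_gauss_density.
have mlin : measurable_fun [set: R * R] (fun z => f (a * z.1 + b * z.2)%R).
  by apply: measurableT_comp => //; exact: measurable_lin2.
rewrite ge0_integral_gauss; last 2 first.
- exact: (measurable_fun_fubini_tonelli_F (m2 := gauss) _ mlin).
- by move=> x; exact: integral_ge0.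
have mgaff c d : measurable_fun [set: R] (fun x => (gauss_density (c * x + d))%:E).
  apply: (@measurable_fun_comp_affine c d (EFin \o gauss_density)).
  exact/measurable_EFinP.
pose h (z : R * R) := (f z.2 *
  (`|b|^-1 * gauss_density (b^-1 * z.2 + (- (a / b) * z.1)) * gauss_density z.1)%:E)%E.
have h0 z : (0 <= h z)%E.
  by rewrite mule_ge0 // lee_fin !mulr_ge0 ?gauss_density_ge0 // invr_ge0.
have mh : measurable_fun [set: R * R] h.
  apply: emeasurable_funM; first exact: measurableT_comp.
  apply/measurable_EFinP/measurable_funM; last exact: measurableT_comp.
  apply: measurable_funM => //; apply: measurableT_comp => //.
  by apply: measurable_funD; apply: measurable_funM.
transitivity (\int[mu]_x \int[mu]_u h (x, u))%E.
  apply: eq_integral => x _.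
  have mfx : measurable_fun [set: R] (fun y => f (a * x + b * y)%R).
    by rewrite (_ : (fun y => _) = (fun y => f (b * y + a * x)%R));
      [exact: measurable_fun_comp_affine|apply/funext => y; rewrite addrC].
  rewrite ge0_integral_gauss //.
  have mhx : measurable_fun [set: R] (fun u => h (x, u)).
    exact: (measurableT_comp mh).
  rewrite [RHS](ge0_integral_affine (a * x) b0) //.
  rewrite -ge0_integralZr//; last 3 first.
  - by apply: emeasurable_funM => //; exact/measurable_EFinP.
  - by move=> y _; rewrite mule_ge0 // lee_fin gauss_density_ge0.
  - by rewrite lee_fin gauss_density_ge0.
  rewrite -ge0_integralZl//; last first.
    exact: (@measurable_fun_comp_affine b (a * x) (fun u => h (x, u))).
  apply: eq_integral => y _; rewrite /h /= [b * y + _]addrC.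
  have -> : b^-1 * (a * x + b * y) + (- (a / b) * x) = y by field.
  rewrite muleCA -muleA; congr (_ * _)%E; rewrite -!EFinM; congr EFin.
  by rewrite !mulrA divff ?mul1r // normr_eq0.
rewrite (fubini_tonelli (m1 := mu) (m2 := mu) h) //.
have mfs : measurable_fun [set: R] (fun x => f (s * x)%R).
  by apply: measurableT_comp => //; exact: measurable_funM.
rewrite ge0_integral_gauss //.
have sV0 : s^-1 != 0 by rewrite invr_neq0.
rewrite [RHS](ge0_integral_affine 0 sV0); last 2 first.
- by apply: emeasurable_funM => //; exact/measurable_EFinP.
- by move=> x; rewrite mule_ge0 // lee_fin gauss_density_ge0.
rewrite -ge0_integralZl//; last 2 first.
- apply: (@measurable_fun_comp_affine s^-1 0 (fun x => f (s * x)%R * (gauss_density x)%:E)%E).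
  by apply: emeasurable_funM => //; exact/measurable_EFinP.
- by move=> x _; rewrite mule_ge0 // lee_fin gauss_density_ge0.
apply: eq_integral => u _; rewrite addr0 mulVKf //.
transitivity (\int[mu]_x ((f u * (`|b|^-1 * gauss_density (s^-1 * u))%:E) *
   (gauss_density (s / b * x + - (a / (s * b)) * u))%:E))%E.
  apply: eq_integral => x _; rewrite /h /= -muleA; congr (_ * _)%E.
  by rewrite -EFinM -mulrA (gauss_densityM _ _ sab) // mulrA.
rewrite ge0_integralZl //; last 3 first.
- exact: mgaff.
- by move=> x _; rewrite lee_fin gauss_density_ge0.
- by rewrite mule_ge0 // lee_fin mulr_ge0 ?gauss_density_ge0 // invr_ge0.
rewrite integral_gauss_density ?mulf_neq0 ?invr_neq0 //.
rewrite -muleA [RHS]muleCA; congr (_ * _)%E; rewrite -!EFinM; congr EFin.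
rewrite !normrM !normrV ?unitfE // invfM invrK.
by field; rewrite !normr_eq0 s0 b0.
Qed.

Lemma gauss_conv a b s f : s ^+ 2 = a ^+ 2 + b ^+ 2 ->
  measurable_fun [set: R] f -> (forall x, 0 <= f x)%E ->
  (\int[gauss]_x \int[gauss]_y f (a * x + b * y)%R = \int[gauss]_x f (s * x)%R)%E.
Proof.
move=> sab mf f0; have [b0|] := eqVneq b 0; last first.
  by move=> b0; exact: gauss_conv_neq0.
have mlin : measurable_fun [set: R * R] (fun z => f (a * z.1 + b * z.2)%R).
  by apply: measurableT_comp => //; exact: measurable_lin2.
have [a0|a0] := eqVneq a 0.
  have s0 : s = 0 by apply/eqP; rewrite -sqrf_eq0 sab a0 b0 expr0n /= addr0.
  rewrite a0 b0 s0; under eq_integral do under eq_integral do rewrite !mul0r addr0.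
  under [in RHS]eq_integral do rewrite mul0r.
  by rewrite integral_cst //= probability_setT mule1.
(* Exchanging the integrals gives the inner variable the nonzero coefficient [a]. *)
rewrite (fubini_tonelli (m1 := gauss) (m2 := gauss) (fun z => f (a * z.1 + b * z.2)%R)) //=.
under eq_integral do under eq_integral do rewrite addrC.
by apply: gauss_conv_neq0 => //; rewrite addrC.
Qed.

(** Both [s = 1] and [s = -1] satisfy [s ^+ 2 = 0 ^+ 2 + 1 ^+ 2], so [gauss_conv] evaluates one
    double integral in two ways. *)
Lemma gauss_even f : measurable_fun [set: R] f -> (forall x, 0 <= f x)%E ->
  (\int[gauss]_x f (- x)%R = \int[gauss]_x f x)%E.
Proof.
move=> mf f0; transitivity (\int[gauss]_x \int[gauss]_y f (0 * x + 1 * y)%R)%E.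
  rewrite (@gauss_conv 0 1 (-1)) //; last by rewrite sqrrN expr0n add0r.
  by apply: eq_integral => x _; rewrite mulN1r.
rewrite (@gauss_conv 0 1 1) //; last by rewrite expr0n add0r.
by apply: eq_integral => x _; rewrite mul1r.
Qed.

(** One-dimensional Cameron-Martin formula, from translation invariance of Lebesgue measure and a
    quotient of densities. It is what lets smoothness in the shift come from the Gaussian rather
    than from [f]. *)
Lemma gauss_shift t f : measurable_fun [set: R] f -> (forall x, 0 <= f x)%E ->
  (\int[gauss]_x f (x + t)%R =
   \int[gauss]_x (f x * (expR (t * x - t ^+ 2 / 2))%:E))%E.
Proof.
move=> mf f0; have mg := measurable_gauss_density.
have me : measurable_fun [set: R] (fun x => (expR (t * x - t ^+ 2 / 2))%:E).
  apply/measurable_EFinP/measurableT_comp => //.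
  by apply: measurable_funB => //; exact: measurable_funM.
have mft : measurable_fun [set: R] (fun x => f (x + t)%R).
  by apply: measurableT_comp => //; exact: measurable_funD.
rewrite ge0_integral_gauss // ge0_integral_gauss; last 2 first.
- exact: emeasurable_funM.
- by move=> x; rewrite mule_ge0 // lee_fin expR_ge0.
rewrite [RHS](ge0_integral_affine t (oner_neq0 R)) ?normr1 ?mul1e; last 2 first.
- by apply: emeasurable_funM; [exact: emeasurable_funM|exact/measurable_EFinP].
- by move=> x; rewrite !mule_ge0 // lee_fin ?expR_ge0 ?gauss_density_ge0.
apply: eq_integral => x _; rewrite mul1r -muleA -EFinM !gauss_densityE.
rewrite mulrCA -expRD; congr (_ * (_ * expR _)%:E)%E.
by field.
Qed.

(** [gauss_shift] applied to the constant 1 says that the Cameron-Martin weight has total mass 1. *)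
Lemma gauss_mgf t : (\int[gauss]_x (expR (t * x))%:E = (expR (t ^+ 2 / 2))%:E)%E.
Proof.
have me : measurable_fun [set: R] (fun x => (expR (t * x - t ^+ 2 / 2))%:E).
  apply/measurable_EFinP/measurableT_comp => //.
  by apply: measurable_funB => //; exact: measurable_funM.
have H : (\int[gauss]_x (1 * (expR (t * x - t ^+ 2 / 2))%:E) = 1)%E.
  rewrite -(@gauss_shift t (cst 1%E)) // ?integral_cst // ?mul1e.
    by rewrite -[RHS](@probability_setT _ _ _ gauss).
have {}H : (\int[gauss]_x (expR (t * x - t ^+ 2 / 2))%:E = 1)%E.
  by rewrite -[RHS]H; apply: eq_integral => x _; rewrite mul1e.
rewrite -[RHS]mule1 -H -ge0_integralZl // ?lee_fin ?expR_ge0 //.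
apply: eq_integral => x _; rewrite -EFinM -expRD; congr (expR _)%:E.
by rewrite addrCA subrr addr0.
Qed.

End lebesgue.

Lemma integral_prob_cst d (T : measurableType d) (R : realType) (P : probability T R)
  (c : \bar R) : (\int[P]__ c = c)%E.
Proof. by rewrite integral_cst // [X in (_ * X)%E]probability_setT mule1. Qed.

Lemma measurable_fun_uncurry d1 d2 d3 d (T1 : measurableType d1) (T2 : measurableType d2)
  (T3 : measurableType d3) (T : measurableType d) (F : T1 -> T2 -> T3)
  (u : T -> T1) (v : T -> T2) :
  measurable_fun setT (fun z => F z.1 z.2) ->
  measurable_fun setT u -> measurable_fun setT v ->
  measurable_fun setT (fun x => F (u x) (v x)).
Proof.
move=> mF mu mv.
exact: (measurableT_comp (f := fun z => F z.1 z.2) mF (measurable_fun_pair mu mv)).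
Qed.

Section tonelli.
Context {R : realType} d1 d2 (T1 : measurableType d1) (T2 : measurableType d2).
Variables (P1 : probability T1 R) (P2 : probability T2 R) (F : T1 -> T2 -> \bar R).
Hypotheses (mF : measurable_fun setT (fun z : T1 * T2 => F z.1 z.2))
  (F0 : forall x y, (0 <= F x y)%E).

Lemma measurable_integral_snd :
  measurable_fun setT (fun x => \int[P2]_y F x y)%E.
Proof. exact: (measurable_fun_fubini_tonelli_F (m2 := P2) _ mF). Qed.

Lemma exchange_integral :
  (\int[P1]_x \int[P2]_y F x y = \int[P2]_y \int[P1]_x F x y)%E.
Proof. exact: (fubini_tonelli (m1 := P1) (m2 := P2) _ mF). Qed.

End tonelli.

(** * Rotation invariance of standard Gaussian vectors *)

Section std_gaussian.
Context {R : realType}.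
Local Notation gauss := (@gauss R).

Definition tup_lin k (a b : R) (z w : k.-tuple R) : k.-tuple R :=
  [tuple a * tnth z i + b * tnth w i | i < k].

Lemma tup_lin_cons k (a b x y : R) (z w : k.-tuple R) :
  tup_lin a b [tuple of x :: z] [tuple of y :: w] =
  [tuple of (a * x + b * y)%R :: tup_lin a b z w].
Proof.
apply: eq_from_tnth => i; rewrite tnth_mktuple.
by case: (unliftP ord0 i) => [j|] ->; rewrite ?tnthS ?tnth0 ?tnth_mktuple.
Qed.

Lemma measurable_tup_lin k (a b : R) :
  measurable_fun [set: k.-tuple R * k.-tuple R] (fun z => tup_lin a b z.1 z.2).
Proof.
apply/measurable_fun_tnthP => i.
rewrite (_ : _ \o _ = fun z => a * tnth z.1 i + b * tnth z.2 i); last first.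
  by apply/funext => z; rewrite /= tnth_mktuple.
by apply: measurable_funD; apply: measurable_funM => //;
  apply: (measurableT_comp (measurable_tnth i)).
Qed.

Definition dot k (a : 'I_k -> R) (z : k.-tuple R) := \sum_(l < k) a l * tnth z l.

Lemma measurable_dot k (a : 'I_k -> R) : measurable_fun [set: k.-tuple R] (dot a).
Proof.
apply: measurable_sum => l; apply: measurable_funM => //.
exact: measurable_tnth.
Qed.

Lemma dot_lin k (a : 'I_k -> R) s t (z w : k.-tuple R) :
  dot a (tup_lin s t z w) = s * dot a z + t * dot a w.
Proof.
rewrite /dot !mulr_sumr -big_split /=; apply: eq_bigr => l _.
by rewrite tnth_mktuple; ring.
Qed.

Lemma ge0_integral_std_gaussianS k (F : k.+1.-tuple R -> \bar R) :
  measurable_fun setT F -> (forall z, 0 <= F z)%E ->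
  (\int[std_gaussian k.+1]_z F z =
   \int[gauss]_x \int[std_gaussian k]_z F [tuple of x :: z])%E.
Proof.
move=> mF F0; rewrite /= ge0_integral_distribution //.
pose G (z : measurableTypeR R * k.-tuple R) := F (cons_tup z).
have mG : measurable_fun setT G.
  by apply: measurableT_comp => //; exact: measurable_cons_tup.
rewrite (fubini_tonelli1 (m1 := normal_prob 0 1) (m2 := std_gaussian k) G) //.
rewrite /gauss ge0_integral_distribution //.
- apply: measurable_integral_snd => //.
- by move=> x; exact: integral_ge0.
- by move=> x; exact: F0.
Qed.

(** Induction on the dimension, with [gauss_conv] for the first coordinate. The term
    [tup_lin s 0 z z] encodes the scalar multiple of [z] by [s]. *)
Lemma std_gaussian_stable k (a b s : R) (F : k.-tuple R -> \bar R) :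
  s ^+ 2 = a ^+ 2 + b ^+ 2 ->
  measurable_fun setT F -> (forall z, 0 <= F z)%E ->
  (\int[std_gaussian k]_z \int[std_gaussian k]_w F (tup_lin a b z w) =
   \int[std_gaussian k]_z F (tup_lin s 0 z z))%E.
Proof.
move=> sab; elim: k F => [|k IH] F mF F0.
  have e (x y : 0.-tuple R) : x = y by rewrite (tuple0 x) (tuple0 y).
  under eq_integral do under eq_integral do rewrite (e (tup_lin _ _ _ _) [tuple]).
  under [in RHS]eq_integral do rewrite (e (tup_lin _ _ _ _) [tuple]).
  by rewrite integral_prob_cst.
have mL := @measurable_tup_lin k a b.
have mFL : measurable_fun [set: k.+1.-tuple R * k.+1.-tuple R]
  (fun z => F (tup_lin a b z.1 z.2)).
  by apply: measurableT_comp => //; exact: measurable_tup_lin.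
rewrite ge0_integral_std_gaussianS; last 2 first.
- exact: measurable_integral_snd.
- by move=> z; exact: integral_ge0.
have mcons d (T : measurableType d) (f : T -> R) (g : T -> k.-tuple R) :
  measurable_fun setT f -> measurable_fun setT g ->
  measurable_fun setT (fun x => F [tuple of f x :: g x]).
  move=> mf mg; apply: (measurableT_comp mF (g := fun x => [tuple of f x :: g x])).
  exact: measurable_cons.
transitivity (\int[gauss]_x \int[std_gaussian k]_z \int[gauss]_y \int[std_gaussian k]_w
  F [tuple of (a * x + b * y)%R :: tup_lin a b z w])%E.
  apply: eq_integral => x _; apply: eq_integral => z _.
  rewrite ge0_integral_std_gaussianS; last 2 first.
  - exact: (measurable_fun_uncurry (F := fun z w => F (tup_lin a b z w)) (u := fun=> _)).
  - by move=> w; exact: F0.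
  by apply: eq_integral => y _; apply: eq_integral => w _; rewrite tup_lin_cons.
(* The tail of the first vector is moved past the head of the second, so that the two heads become
   adjacent and the two tails fall under the induction hypothesis. *)
transitivity (\int[gauss]_x \int[gauss]_y \int[std_gaussian k]_z \int[std_gaussian k]_w
  F [tuple of (a * x + b * y)%R :: tup_lin a b z w])%E.
  apply: eq_integral => x _; apply: exchange_integral; last first.
    by move=> z y; exact: integral_ge0.
  apply: (@measurable_integral_snd _ _ _ _ _ (std_gaussian k)
    (fun (p : k.-tuple R * R) w => F [tuple of (a * x + b * p.2)%R :: tup_lin a b p.1 w])) => //=.
  apply: mcons.
    apply: measurable_funD => //; apply: measurable_funM => //.
    exact: measurableT_comp.
  by apply: (measurable_fun_uncurry mL) => //; exact: measurableT_comp.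
transitivity (\int[gauss]_x \int[gauss]_y \int[std_gaussian k]_z
  F [tuple of (a * x + b * y)%R :: tup_lin s 0 z z])%E.
  apply: eq_integral => x _; apply: eq_integral => y _.
  apply: (IH (fun z => F [tuple of (a * x + b * y)%R :: z])) => //.
  exact: mcons.
have mdiag : measurable_fun [set: k.-tuple R] (fun z => tup_lin s 0 z z).
  exact: (measurable_fun_uncurry (@measurable_tup_lin _ s 0)).
rewrite (gauss_conv (f := fun x => \int[std_gaussian k]_z
  F [tuple of x :: tup_lin s 0 z z])%E sab).
- rewrite ge0_integral_std_gaussianS; last 2 first.
  + apply: (measurableT_comp mF (g := fun z => tup_lin s 0 z z)).
    exact: (measurable_fun_uncurry (@measurable_tup_lin _ s 0)).
  + by move=> z; exact: F0.
  apply: eq_integral => x _; apply: eq_integral => z _.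
  by rewrite tup_lin_cons mul0r addr0.
- apply: measurable_integral_snd => //; apply: mcons => //.
  exact: (measurable_fun_uncurry (@measurable_tup_lin _ s 0)).
- by move=> x; exact: integral_ge0.
Qed.

(** A linear form of a standard Gaussian vector is its norm times one standard variable: the tail of
    [a] is replaced by its norm [s'], then [gauss_conv] merges it with the head. Either square root
    is allowed for [s]. *)
Lemma std_gaussian_dot k (a : 'I_k -> R) (s : R) (f : R -> \bar R) :
  s ^+ 2 = \sum_(l < k) a l ^+ 2 ->
  measurable_fun setT f -> (forall x, 0 <= f x)%E ->
  (\int[std_gaussian k]_z f (dot a z) = \int[gauss]_x f (s * x)%R)%E.
Proof.
elim: k a s f => [|k IH] a s f sa mf f0.
  have -> : s = 0 by apply/eqP; rewrite -sqrf_eq0 sa big_ord0.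
  under eq_integral do rewrite /dot big_ord0.
  under [in RHS]eq_integral do rewrite mul0r.
  by rewrite !integral_prob_cst.
pose a' l := a (lift ord0 l).
pose s' := Num.sqrt (\sum_(l < k) a' l ^+ 2).
have s'E : s' ^+ 2 = \sum_(l < k) a' l ^+ 2.
  by rewrite sqr_sqrtr // sumr_ge0 // => l _; exact: sqr_ge0.
rewrite ge0_integral_std_gaussianS //; last first.
  by apply: measurableT_comp => //; exact: measurable_dot.
transitivity (\int[gauss]_x \int[gauss]_y f (a ord0 * x + s' * y)%R)%E; last first.
  by apply: gauss_conv => //; rewrite sa big_ord_recl s'E.
apply: eq_integral => x _.
rewrite -(IH a' s' (fun y => f (a ord0 * x + y)%R)) //; last first.
  by apply: measurableT_comp => //; exact: measurable_funD.
apply: eq_integral => z _; congr (f _).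
rewrite /dot big_ord_recl tnth0; congr (_ + _).
by apply: eq_bigr => l _; rewrite tnthS.
Qed.

End std_gaussian.

(** * Taylor remainders of the exponential on the whole line *)

Section exp_taylor.
Context {R : realType}.
Implicit Types t : R.

Lemma series_exp_coeff_le t n : 0 <= t -> series (exp_coeff t) n <= expR t.
Proof.
move=> t0; apply: nondecreasing_cvgn_le; last exact: is_cvg_series_exp_coeff.
by apply: nondecreasing_series => k _ _; exact: exp_coeff_ge0.
Qed.

(** Termwise comparison: in the tail, [(i + m)! >= i!] lets the factor [t ^+ m] be pulled out and
    leaves a partial sum of the series of [expR] at the absolute value. *)
Lemma expR_taylor m t :
  `|expR t - \sum_(k < m) t ^+ k / k`!%:R| <= `|t| ^+ m * expR `|t|.
Proof.
have H N : `|series (exp_coeff t) (N + m)%N - \sum_(k < m) t ^+ k / k`!%:R| <=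
   `|t| ^+ m * expR `|t|.
  rewrite /series /= -(big_mkord xpredT (fun k => t ^+ k / k`!%:R)).
  rewrite (big_cat_nat (n := m)) //=; last exact: leq_addl.
  rewrite addrAC subrr add0r -{1}[m]add0n big_addn addnK.
  rewrite (le_trans (ler_norm_sum _ _ _)) //.
  apply: (@le_trans _ _ (`|t| ^+ m * series (exp_coeff `|t|) N)); last first.
    by rewrite ler_wpM2l ?exprn_ge0 //; exact: series_exp_coeff_le.
  rewrite /series /= mulr_sumr ler_sum // => i _.
  rewrite /exp_coeff /= normrM normrX normfV (ger0_norm (ler0n _ _)).
  rewrite addnC exprD -mulrA ler_wpM2l ?exprn_ge0 // ler_wpM2l ?exprn_ge0 //.
  by rewrite lef_pV2 ?posrE ?ltr0n ?fact_gt0 // ler_nat leq_fact // leq_addl.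
have C : `|series (exp_coeff t) (N + m)%N - \sum_(k < m) t ^+ k / k`!%:R| @[N --> \oo]
   --> `|expR t - \sum_(k < m) t ^+ k / k`!%:R|.
  apply: cvg_norm; apply: cvgB; last exact: cvg_cst.
  rewrite (cvg_shiftn m (series (exp_coeff t))).
  exact: is_cvg_series_exp_coeff.
rewrite -(cvg_lim _ C) //; apply: limr_le; first exact: cvgP C.
exact: nearW.
Qed.

Lemma expR_taylor2 t : `|expR t - (1 + t)| <= t ^+ 2 * expR `|t|.
Proof.
have := expR_taylor 2 t; rewrite !big_ord_recr big_ord0 /= add0r.
by rewrite expr0 expr1 fact0 !divr1 real_normK // num_real.
Qed.

Lemma expR_taylor3 t : `|expR t - (1 + t + t ^+ 2 / 2)| <= `|t| ^+ 3 * expR `|t|.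
Proof.
have := expR_taylor 3 t; rewrite !big_ord_recr big_ord0 /= add0r.
by rewrite expr0 expr1 fact0 !divr1.
Qed.

End exp_taylor.

(** * Integrals dominated by an exponential weight *)

Section gauss_weight.
Context {R : realType}.
Local Notation gauss := (@gauss R).

(* A weight with explicit Gaussian integral that dominates (1 + |x|)^3, the
   size of all remainders below. *)
Definition expw (x : R) : R := expR (3 * x) + expR (- 3 * x).

Lemma measurable_expw : measurable_fun [set: R] expw.
Proof.
by apply: measurable_funD; apply: measurableT_comp => //; exact: measurable_funM.
Qed.

Lemma expw_ge (x : R) : expR (3 * `|x|) <= expw x.
Proof.
rewrite /expw; have [x0|x0] := ger0P x; first by rewrite lerDl expR_ge0.
by rewrite mulrN mulNr lerDr expR_ge0.
Qed.

Lemma expw_ge0 (x : R) : 0 <= expw x.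
Proof. by rewrite addr_ge0 ?expR_ge0. Qed.

Lemma expw_ge_norm (x : R) : 1 + `|x| <= expw x.
Proof.
apply: le_trans (expw_ge x); apply: (le_trans (expR_ge1Dx _)).
by rewrite ler_expR; have := normr_ge0 x; lra.
Qed.

Lemma expw_ge_cube (x : R) : (1 + `|x|) ^+ 3 <= expw x.
Proof.
apply: le_trans (expw_ge x); rewrite expRM_natl lerXn2r ?nnegrE ?expR_ge0 ?addr_ge0 //.
exact: expR_ge1Dx.
Qed.

Lemma integral_expw : (\int[gauss]_x (expw x)%:E = (2 * expR (9 / 2))%:E)%E.
Proof.
have me c : measurable_fun [set: R] (fun x => (expR (c * x))%:E).
  by apply/measurable_EFinP/measurableT_comp => //; exact: measurable_funM.
under eq_integral do rewrite /expw EFinD.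
rewrite ge0_integralD //.
rewrite !gauss_mgf -EFinD; congr EFin.
by rewrite sqrrN (_ : 3 ^+ 2 = 9 :> R); ring.
Qed.

Lemma integrable_expw (f : R -> R) C : measurable_fun [set: R] f ->
  (forall x, `|f x| <= C * expw x) -> gauss.-integrable setT (EFin \o f).
Proof.
move=> mf fC.
apply: (@le_integrable _ _ _ gauss _ measurableT _ (fun x => (C%:E * (expw x)%:E)%E)).
- exact/measurable_EFinP.
- move=> x _ /=; rewrite lee_fin (le_trans (fC x)) //= ler_norm //.
- apply: integrableZl => //; apply/integrableP; split.
    by apply/measurable_EFinP; exact: measurable_expw.
  under eq_integral do rewrite gee0_abs ?lee_fin ?expw_ge0 //.
  by rewrite integral_expw ltry.
Qed.

Lemma Rintegral_expw : \int[gauss]_x expw x = 2 * expR (9 / 2).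
Proof. by rewrite /Rintegral integral_expw. Qed.

Lemma normr_Rintegral_expw (f : R -> R) C : measurable_fun [set: R] f ->
  (forall x, `|f x| <= C * expw x) ->
  `|\int[gauss]_x f x| <= C * (2 * expR (9 / 2)).
Proof.
move=> mf fC; have fi := integrable_expw mf fC.
have wi : gauss.-integrable setT (EFin \o expw).
  apply: (integrable_expw (C := 1)) => [|x]; first exact: measurable_expw.
  by rewrite mul1r ger0_norm ?expw_ge0.
apply: (le_trans (le_normr_Rintegral measurableT fi)).
rewrite -Rintegral_expw -RintegralZl //; apply: le_Rintegral => //.
- apply: (integrable_expw (C := C)) => [|x]; first exact: measurableT_comp.
  by rewrite normr_id.
- have := integrableZl measurableT C wi.
  by under [X in _ -> integrable _ _ X]eq_fun do rewrite /= EFinM.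
Qed.

End gauss_weight.

Lemma ler_norm_sub_bounds (R : realType) (b B u v : R) : 0 <= b ->
  b <= u -> u <= B -> b <= v -> v <= B -> `|u - v| <= B.
Proof. by move=> *; rewrite ler_norml; apply/andP; split; lra. Qed.

(** * The heat semigroup *)

Section heat.
Context {R : realType}.
Local Notation gauss := (@gauss R).
Implicit Types (g : R -> R) (s x y B : R).

(** The parameter is a standard deviation, not a time: the heat time is [s ^+ 2], which is why
    squares add in [heat_semigroup]. *)
Definition heat g s x : R := \int[gauss]_y g (x + s * y).

Lemma measurable_shift_scale g s x : measurable_fun setT g ->
  measurable_fun [set: R] (fun y => g (x + s * y)).
Proof.
move=> mg; apply: measurableT_comp => //.
by apply: measurable_funD => //; exact: measurable_funM.
Qed.

Section bounded.
Variables (g : R -> R) (b B : R).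
Hypotheses (mg : measurable_fun setT g) (b0 : 0 <= b)
  (gb : forall x, b <= g x <= B).

Let g0 x : 0 <= g x.
Proof. by have /andP[+ _] := gb x; exact: le_trans. Qed.

Let gB x : g x <= B.
Proof. by have /andP[] := gb x. Qed.

Let B0 : 0 <= B.
Proof. exact: le_trans (g0 0) (gB 0). Qed.

Lemma integrable_heat s x :
  gauss.-integrable setT (EFin \o (fun y => g (x + s * y))).
Proof.
apply: (integrable_expw (C := B)) => [|y]; first exact: measurable_shift_scale.
rewrite ger0_norm // (le_trans (gB _)) // ler_peMr //.
by apply: le_trans (expw_ge_norm _); rewrite lerDl.
Qed.

Lemma EFin_heat s x : (heat g s x)%:E = (\int[gauss]_y (g (x + s * y))%:E)%E.
Proof.
rewrite /heat /Rintegral fineK //.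
exact: integrable_fin_num (integrable_heat s x).
Qed.

Lemma heat_bounds s x : b <= heat g s x <= B.
Proof.
rewrite -!lee_fin EFin_heat; apply/andP; split.
- rewrite -[leLHS](integral_prob_cst gauss); apply: ge0_le_integral => //.
  + by apply/measurable_EFinP; exact: measurable_shift_scale.
  + by move=> y _; rewrite lee_fin; have /andP[] := gb (x + s * y).
- rewrite -[leRHS](integral_prob_cst gauss); apply: ge0_le_integral => //.
  + by move=> y _; rewrite lee_fin.
  + by apply/measurable_EFinP; exact: measurable_shift_scale.
  + by move=> y _; rewrite lee_fin.
Qed.

Lemma measurable_heat s : measurable_fun setT (heat g s).
Proof.
apply/measurable_EFinP.
rewrite (_ : _ \o _ = fun x => (\int[gauss]_y (g (x + s * y))%:E)%E); last first.
  by apply/funext => x; exact: EFin_heat.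
apply: measurable_integral_snd => [|x y]; last by rewrite lee_fin.
apply/measurable_EFinP; apply: (measurableT_comp mg).
by apply: measurable_funD => //; exact: measurable_funM.
Qed.

Lemma heat_semigroup a c s x : s ^+ 2 = a ^+ 2 + c ^+ 2 ->
  (\int[gauss]_y (heat g c (x + a * y))%:E = (heat g s x)%:E)%E.
Proof.
move=> sac; rewrite EFin_heat.
rewrite -(gauss_conv (f := fun y => (g (x + y))%:E) sac).
- apply: eq_integral => y _; rewrite EFin_heat.
  by apply: eq_integral => w _; rewrite addrA.
- by apply/measurable_EFinP/measurableT_comp => //; exact: measurable_funD.
- by move=> y; rewrite lee_fin.
Qed.

Local Notation M := (2 * expR (9 / 2) : R).

(* The derivative of [heat g s], by Gaussian integration by parts; it makes sense
   for merely measurable [g]. *)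
Definition heat_slope s x : R := s^-1 * \int[gauss]_w (g (x + s * w) * w).

Let slope_le x s w : `|g (x + s * w) * w| <= B * expw w.
Proof.
rewrite normrM (ger0_norm (g0 _)) ler_pM //.
by apply: le_trans (expw_ge_norm _); rewrite lerDr.
Qed.

Let measurable_slope x s : measurable_fun [set: R] (fun w => g (x + s * w) * w).
Proof. by apply: measurable_funM => //; exact: measurable_shift_scale. Qed.

Lemma heat_slope_le s x : 0 < s -> `|heat_slope s x| <= B * M / s.
Proof.
move=> s0; rewrite /heat_slope normrM mulrC (gtr0_norm (_ : 0 < s^-1)) ?invr_gt0 //.
by rewrite ler_pM2r ?invr_gt0 //; exact: normr_Rintegral_expw.
Qed.

(** Second-order Taylor bound at the exponent [v], which is at most [|t| (1 + |w|)] in absolute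
    value. The square of [1 + |w|] costs [expR (2 |w|)] and the exponential factor costs
    [expR (1 + |w|)]; together they give [expR 1] times the weight [expR (3 |w|)] inside [expw]. *)
Lemma cameron_martin_weight_taylor (t w : R) : `|t| <= 1 ->
  `|expR (t * w - t ^+ 2 / 2) - (1 + t * w)| <= t ^+ 2 * (expR 1 + 1) * expw w.
Proof.
move=> t1; set v := t * w - t ^+ 2 / 2.
have vE : `|v| <= `|t| * (1 + `|w|).
  rewrite /v (le_trans (ler_normB _ _)) // normrM mulrDr mulr1 addrC lerD2r.
  rewrite ger0_norm ?divr_ge0 ?sqr_ge0 // -(real_normK (num_real t)).
  rewrite expr2 -mulrA ler_piMr //; have := normr_ge0 t; lra.
have v1 : `|v| <= 1 + `|w|.
  by rewrite (le_trans vE) // ler_piMl // addr_ge0.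
have v2 : v ^+ 2 <= t ^+ 2 * (1 + `|w|) ^+ 2.
  rewrite -(real_normK (num_real v)) -(real_normK (num_real t)) -exprMn.
  by rewrite lerXn2r // nnegrE // mulr_ge0 // addr_ge0.
have e2 : (1 + `|w|) ^+ 2 <= expR (2 * `|w|).
  rewrite expRM_natl lerXn2r ?nnegrE ?expR_ge0 ?addr_ge0 //.
  exact: expR_ge1Dx.
have -> : expR v - (1 + t * w) = (expR v - (1 + v)) - t ^+ 2 / 2.
  by rewrite /v; ring.
rewrite (le_trans (ler_normB _ _)) //.
rewrite (_ : t ^+ 2 * _ * _ = t ^+ 2 * (expR 1 * expw w) + t ^+ 2 * expw w); last by ring.
apply: lerD.
  apply: (le_trans (expR_taylor2 _)).
  apply: (le_trans (ler_wpM2r (expR_ge0 _) v2)).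
  rewrite -mulrA ler_wpM2l ?sqr_ge0 //.
  apply: (le_trans (ler_pM _ _ e2 (_ : _ <= expR (1 + `|w|)))).
  - exact: sqr_ge0.
  - exact: expR_ge0.
  - by rewrite ler_expR.
  - rewrite -expRD addrCA expRD ler_wpM2l ?expR_ge0 //.
    by apply: le_trans (expw_ge _); rewrite ler_expR; lra.
rewrite ger0_norm ?divr_ge0 ?sqr_ge0 // ler_wpM2l ?sqr_ge0 //.
apply: le_trans (expw_ge_norm _).
by have := normr_ge0 w; lra.
Qed.

(** The shift [y] is absorbed into the Gaussian weight, and the weight is expanded in [t = y / s];
    its linear coefficient is [heat_slope]. The factor [expR 1 + 1] comes from small [t], the factor
    [1 + M] from large [t], and their product covers both. *)
Lemma heat_taylor s x y : 0 < s ->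
  `|heat g s (x + y) - heat g s x - heat_slope s x * y| <=
  B * (expR 1 + 1) * (1 + M) * (y / s) ^+ 2.
Proof.
move=> s0; set t := y / s.
have M0 : 0 <= M by rewrite mulr_ge0 ?expR_ge0.
have e0 : 0 <= expR 1 :> R by exact: expR_ge0.
(* For [|t| > 1] the expansion is useless, but each term is trivially at most a multiple of
   [t ^+ 2]. *)
have [t1|t1] := leP `|t| 1; last first.
  have /andP[h1 h2] := heat_bounds s (x + y).
  have /andP[h3 h4] := heat_bounds s x.
  have dB : `|heat g s (x + y) - heat g s x| <= B.
    exact: (ler_norm_sub_bounds b0).
  have sB : `|heat_slope s x * y| <= B * M * `|t|.
    rewrite normrM (le_trans (ler_wpM2r (normr_ge0 _) (heat_slope_le x s0))) //.
    have -> : `|t| = `|y| / s by rewrite /t normrM normfV (gtr0_norm s0).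
    by rewrite [leLHS]mulrAC -[leLHS]mulrA.
  rewrite (le_trans (ler_normB _ _)) // (le_trans (lerD dB sB)) //.
  have t12 : 1 <= t ^+ 2 by rewrite -(real_normK (num_real t)) exprn_ege1 // ltW.
  have tt2 : `|t| <= t ^+ 2.
    by rewrite -(real_normK (num_real t)) expr2 ler_peMr // ltW.
  have BM0 : 0 <= B * M by rewrite mulr_ge0.
  apply: (@le_trans _ _ (B * (1 + M) * t ^+ 2)).
    rewrite mulrDr mulr1 mulrDl lerD //; first by rewrite ler_peMr.
    by rewrite ler_wpM2l.
  rewrite ler_wpM2r ?sqr_ge0 // ler_wpM2r ?addr_ge0 //.
  by rewrite ler_peMr // lerDr.
pose G w := g (x + s * w).
have mG : measurable_fun setT G by exact: measurable_shift_scale.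
pose W w := expR (t * w - t ^+ 2 / 2).
have mW : measurable_fun setT W.
  apply: measurableT_comp => //.
  by apply: measurable_funB => //; exact: measurable_funM.
(* Since [x + y + s w = x + s (w + t)], this is [gauss_shift] by [t]. *)
have hxy : heat g s (x + y) = \int[gauss]_w (G w * W w).
  rewrite /heat /Rintegral; congr fine.
  under [RHS]eq_integral do rewrite EFinM.
  rewrite -(@gauss_shift _ t (fun w => (G w)%:E)); last 2 first.
  - exact/measurable_EFinP.
  - by move=> w; rewrite lee_fin /G.
  apply: eq_integral => w _; congr (g _)%:E; rewrite /t.
  by field; rewrite gt_eqF.
have Wle w : `|W w - (1 + t * w)| <= t ^+ 2 * (expR 1 + 1) * expw w.
  exact: cameron_martin_weight_taylor.
have mw : measurable_fun [set: R] (fun w => t * (G w * w)).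
  by apply: measurable_funM => //; exact: measurable_slope.
have t21 : t ^+ 2 <= 1.
  by rewrite -(real_normK (num_real t)) exprn_ile1.
have GWi : gauss.-integrable setT (EFin \o (fun w => G w * W w)).
  apply: (integrable_expw (C := B * (expR 1 + 3))); first exact: measurable_funM.
  move=> w; rewrite normrM (ger0_norm (g0 _)) -mulrA ler_pM //.
  have -> : W w = (W w - (1 + t * w)) + 1 + t * w by ring.
  rewrite (le_trans (ler_normD _ _)) // (le_trans (lerD (ler_normD _ _) (lexx _))) //.
  rewrite normr1 normrM.
  have h1 : t ^+ 2 * (expR 1 + 1) * expw w <= (expR 1 + 1) * expw w.
    have c0 : 0 <= (expR 1 + 1) * expw w.
      by apply: mulr_ge0; [exact: addr_ge0|exact: expw_ge0].
    by rewrite -mulrA; exact: ler_piMl.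
  have h2 : `|t| * `|w| <= `|w| by rewrite ler_piMl.
  have := Wle w; have := expw_ge_norm w; have := normr_ge0 w; lra.
have Gi : gauss.-integrable setT (EFin \o G) by exact: integrable_heat.
have Gwi : gauss.-integrable setT (EFin \o (fun w => t * (G w * w))).
  apply: (integrable_expw (C := B)) => // w; rewrite normrM.
  by rewrite (le_trans _ (slope_le x s w)) // ler_piMl.
have -> : heat_slope s x * y = \int[gauss]_w (t * (G w * w)).
  rewrite RintegralZl //; last first.
    apply: (integrable_expw (C := B)) => [|w]; [exact: measurable_slope|exact: slope_le].
  by rewrite /heat_slope /t mulrC mulrA.
rewrite hxy /heat -RintegralB // -RintegralB //; last first.
  have := integrableB measurableT GWi Gi.
  by under [X in integrable _ _ X -> _]eq_fun do rewrite /= -EFinB.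
rewrite (_ : B * _ * _ * _ = B * (expR 1 + 1) * t ^+ 2 * M + B * (expR 1 + 1) * t ^+ 2); last by ring.
rewrite (@le_trans _ _ (B * (expR 1 + 1) * t ^+ 2 * M)) //; last first.
  by rewrite lerDl mulr_ge0 ?sqr_ge0 // mulr_ge0 // addr_ge0.
apply: normr_Rintegral_expw.
  by do 2 (apply: measurable_funB => //); exact: measurable_funM.
move=> w.
have -> : G w * W w - g (x + s * w) - t * (G w * w) = G w * (W w - (1 + t * w)).
  by rewrite /G; ring.
rewrite normrM (ger0_norm (g0 _)).
apply: (le_trans (ler_pM (g0 _) (normr_ge0 _) (gB _) (Wle w))).
by rewrite le_eqVlt; apply/orP; left; apply/eqP; ring.
Qed.

End bounded.

End heat.

(** * Expansion of a weighted geometric mean to second order *)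

Section log_expansion.
Context {R : realType}.

(** The logarithm itself is never expanded: since [expR v = 1 + p], the Taylor bounds of [expR] at
    [v], read backwards, control [v - p] and [v - (p - v ^+ 2 / 2)]. Trading [v ^+ 2] for [p ^+ 2]
    costs one more cubic term. This holds for all quotients up to [L = B / dl], also beyond the
    radius of convergence of the logarithmic series. *)
Lemma ln_quotient_expansion (dl B : R) : 0 < dl -> dl <= B -> exists2 C : R, 0 <= C &
  forall q u r : R, dl <= q <= B -> dl <= u <= B -> `|q / u - 1| <= r ->
  let p := q / u - 1 in let v := ln (q / u) in
  [/\ `|v| <= C, `|v| <= C * r, `|v - p| <= C * r ^+ 2 &
      `|v - (p - p ^+ 2 / 2)| <= C * r ^+ 3].
Proof.
move=> dl0 dlB; pose L := B / dl.
have B0 : 0 < B by exact: lt_le_trans dlB.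
have L1 : 1 <= L by rewrite /L ler_pdivlMr // mul1r.
have L0 : 0 < L by lra.
pose E := expR (L ^+ 2); have E1 : 1 <= E.
  by rewrite /E -[leLHS]expR0 ler_expR sqr_ge0.
have LL : 1 <= L ^+ 2 by rewrite exprn_ege1.
have LL2 : L ^+ 2 <= L ^+ 3 by rewrite [leRHS]exprS ler_peMl // sqr_ge0.
have L3E : L ^+ 3 <= L ^+ 3 * E by rewrite ler_peMr // exprn_ge0 // ltW.
have E0 : 0 <= E by exact: expR_ge0.
have L30 : 0 <= L ^+ 3 by rewrite exprn_ge0 // ltW.
have C0 : 0 <= L ^+ 3 * E by exact: mulr_ge0.
have C2 : L ^+ 3 * E <= 2 * L ^+ 3 * E by rewrite -mulrA ler_peMl // ler1n.
exists (2 * L ^+ 3 * E); first exact: le_trans C2.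
move=> q u r /andP[q1 q2] /andP[u1 u2] pr p v.
have q0 : 0 < q by exact: lt_le_trans q1.
have u0 : 0 < u by exact: lt_le_trans u1.
have qu0 : 0 < q / u by rewrite divr_gt0.
have r0 : 0 <= r by exact: le_trans pr.
have q0' := ltW q0; have u0' := ltW u0.
have quL : q / u <= L by rewrite /L ler_pM ?invr_ge0 // lef_pV2.
have uqL : u / q <= L by rewrite /L ler_pM ?invr_ge0 // lef_pV2.
have ev : expR v = 1 + p by rewrite /v lnK // /p; ring.
have p1 : -1 < p by rewrite /p; lra.
have pL : `|p| <= L by rewrite ler_norml /p; apply/andP; split; lra.
have vp : v <= p by rewrite /v (_ : q / u = 1 + p) ?le_ln1Dx // /p; ring.
(* The upper bound is [ln (1 + p) <= p]; the lower bound is the same inequality for the inverse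
   quotient [u / q]. *)
have vL : `|v| <= L * `|p|.
  have nv : - v <= L * `|p|.
    have -> : - v = ln (1 + (u / q - 1)).
      by rewrite /v -lnV // invf_div; congr ln; ring.
    apply: (le_trans (le_ln1Dx _)); first by have := divr_gt0 u0 q0; lra.
    have -> : u / q - 1 = u / q * - p.
      by rewrite /p; field; rewrite !gt_eqF.
    apply: (@le_trans _ _ (u / q * `|p|)).
      by rewrite ler_wpM2l ?divr_ge0 ?(ltW u0) ?(ltW q0) // -normrN ler_norm.
    by rewrite ler_wpM2r.
  rewrite ler_norml -[- _ <= v]lerNl nv /= (le_trans vp) //.
  by rewrite (le_trans (ler_norm _)) // ler_peMl.
have vL2 : `|v| <= L ^+ 2 by rewrite (le_trans vL) // expr2 ler_pM2l.
have vr : `|v| <= L * r by rewrite (le_trans vL) // ler_pM2l.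
have evE : expR `|v| <= E by rewrite ler_expR.
have vp2 : `|v - p| <= L ^+ 2 * E * r ^+ 2.
  have := expR_taylor2 v; rewrite ev (_ : 1 + p - (1 + v) = p - v); last by ring.
  rewrite distrC => /le_trans; apply.
  rewrite [leRHS]mulrAC -exprMn -(real_normK (num_real v)) ler_pM ?expR_ge0 ?sqr_ge0 //.
  by rewrite lerXn2r // nnegrE // mulr_ge0 // ltW.
have r3 : 0 <= r ^+ 3 by rewrite exprn_ge0.
have v3 : `|v - (p - v ^+ 2 / 2)| <= L ^+ 3 * E * r ^+ 3.
  have := expR_taylor3 v.
  rewrite ev (_ : 1 + p - _ = - (v - (p - v ^+ 2 / 2))); last by field.
  rewrite normrN => /le_trans; apply.
  rewrite [leRHS]mulrAC -exprMn ler_pM ?expR_ge0 ?exprn_ge0 //.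
  by rewrite lerXn2r // nnegrE // mulr_ge0 // ltW.
have v2p2 : `|v ^+ 2 - p ^+ 2| <= 2 * L ^+ 3 * E * r ^+ 3.
  have -> : v ^+ 2 - p ^+ 2 = (v - p) * (v + p) by ring.
  rewrite normrM.
  have vpr : `|v + p| <= 2 * L * r.
    rewrite (le_trans (ler_normD _ _)) // (le_trans (lerD vr pr)) //.
    by rewrite -mulrA mulr_natl mulr2n lerD2l ler_peMl.
  apply: (le_trans (ler_pM _ _ vp2 vpr)) => //.
  by rewrite le_eqVlt; apply/orP; left; apply/eqP; ring.
split.
- by rewrite (le_trans vL2) // (le_trans LL2) // (le_trans L3E).
- rewrite (le_trans vr) // ler_wpM2r //.
  have LL3 : L <= L ^+ 3 by rewrite [leRHS]exprS ler_peMr // ltW.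
  by rewrite (le_trans LL3) // (le_trans L3E).
- rewrite (le_trans vp2) // ler_wpM2r ?sqr_ge0 // ler_wpM2r ?expR_ge0 //.
  lra.
- rewrite (_ : v - _ = (v - (p - v ^+ 2 / 2)) - (v ^+ 2 - p ^+ 2) / 2); last by field.
  rewrite (le_trans (ler_normB _ _)) // normrM (ger0_norm (_ : 0 <= 2^-1)) //.
  rewrite (_ : 2 * L ^+ 3 * E * r ^+ 3 = L ^+ 3 * E * r ^+ 3 + (2 * L ^+ 3 * E * r ^+ 3) / 2); last by field.
  by rewrite lerD // ler_wpM2r.
Qed.

Lemma ler_norm_wsum m (c x : 'I_m -> R) X : (forall j, 0 <= c j) ->
  (forall j, `|x j| <= X) -> `|\sum_(j < m) c j * x j| <= (\sum_(j < m) c j) * X.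
Proof.
move=> c0 xX; rewrite (le_trans (ler_norm_sum _ _ _)) // mulr_suml ler_sum // => j _.
by rewrite normrM ger0_norm // ler_wpM2l.
Qed.

Lemma ler_sqrB_norm (x y d e : R) : `|x - y| <= d -> `|x| <= e -> `|y| <= e ->
  `|x ^+ 2 - y ^+ 2| <= d * (2 * e).
Proof.
move=> xyd xe ye; have -> : x ^+ 2 - y ^+ 2 = (x - y) * (x + y) by ring.
rewrite normrM ler_pM // (le_trans (ler_normD _ _)) //; lra.
Qed.

(* [v j] is the log-quotient of a step, [p j] its quotient minus 1 and [b j] the
   linear part of [p j]: the quadratic terms are the two sides of [P >= Sigma]. *)
Lemma expR_wsum_expansion m (c : 'I_m -> R) C : (forall j, 0 <= c j) -> 0 <= C ->
  exists2 C' : R, 0 <= C' & forall (v p b : 'I_m -> R) (r : R), 0 <= r ->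
  (forall j, `|v j| <= C) -> (forall j, `|v j| <= C * r) ->
  (forall j, `|v j - p j| <= C * r ^+ 2) ->
  (forall j, `|v j - (p j - p j ^+ 2 / 2)| <= C * r ^+ 3) ->
  (forall j, `|p j| <= C * r) -> (forall j, `|b j| <= C * r) ->
  (forall j, `|p j - b j| <= C * r ^+ 2) ->
  expR (\sum_(j < m) c j * v j) + 2^-1 * \sum_(j < m) c j * b j ^+ 2 <=
  1 + \sum_(j < m) c j * p j + 2^-1 * (\sum_(j < m) c j * b j) ^+ 2 + C' * r ^+ 3.
Proof.
move=> c0 C0; pose S := \sum_(j < m) c j.
have S0 : 0 <= S by exact: sumr_ge0.
exists (S ^+ 3 * C ^+ 3 * expR (S * C) + S * C + S * C ^+ 2 + 2 * S ^+ 2 * C ^+ 2).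
  by rewrite !addr_ge0 ?mulr_ge0 ?exprn_ge0 ?expR_ge0.
move=> v p b r r0 vC vr vp vpp pr br pb.
set T := \sum_(j < m) c j * v j; set t := \sum_(j < m) c j * b j.
have Tr : `|T| <= S * (C * r) by exact: ler_norm_wsum.
have TC : `|T| <= S * C by exact: ler_norm_wsum.
have tr : `|t| <= S * (C * r) by exact: ler_norm_wsum.
have Tt : `|T - t| <= S * (2 * C * r ^+ 2).
  rewrite /T /t -sumrB; under eq_bigr do rewrite -mulrBr.
  apply: ler_norm_wsum => // j.
  rewrite (_ : v j - b j = (v j - p j) + (p j - b j)); last by ring.
  rewrite (le_trans (ler_normD _ _)) //; have := vp j; have := pb j; lra.
have T2 : T ^+ 2 <= t ^+ 2 + 4 * S ^+ 2 * C ^+ 2 * r ^+ 3.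
  have := ler_sqrB_norm Tt Tr tr.
  rewrite (_ : S * _ * _ = 4 * S ^+ 2 * C ^+ 2 * r ^+ 3); last by ring.
  by have := ler_norm (T ^+ 2 - t ^+ 2); lra.
(* The term [- p ^+ 2 / 2] of the logarithm, with [p] replaced by its linear part [b], is the
   discrete Ito correction that ends up on the left-hand side. *)
have Tp : T <= \sum_(j < m) c j * p j - 2^-1 * (\sum_(j < m) c j * b j ^+ 2) +
    S * (C * r ^+ 3 + C ^+ 2 * r ^+ 3).
  rewrite /T mulr_sumr -sumrB mulr_suml -big_split /= ler_sum // => j _.
  rewrite (_ : c j * p j - _ + _ = c j * (p j - b j ^+ 2 / 2 + (C * r ^+ 3 + C ^+ 2 * r ^+ 3))); last by field.
  rewrite ler_wpM2l //.
  have := ler_sqrB_norm (pb j) (pr j) (br j).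
  rewrite (_ : C * r ^+ 2 * (2 * (C * r)) = 2 * (C ^+ 2 * r ^+ 3)); last by ring.
  rewrite distrC => /(le_trans (ler_norm _)).
  have := le_trans (ler_norm _) (vpp j); lra.
have eT : expR T <= 1 + T + T ^+ 2 / 2 + S ^+ 3 * C ^+ 3 * expR (S * C) * r ^+ 3.
  have := le_trans (ler_norm _) (expR_taylor3 T).
  have : `|T| ^+ 3 * expR `|T| <= S ^+ 3 * C ^+ 3 * expR (S * C) * r ^+ 3.
    rewrite (_ : _ * r ^+ 3 = (S * (C * r)) ^+ 3 * expR (S * C)); last by ring.
    rewrite ler_pM ?exprn_ge0 ?expR_ge0 ?ler_expR //.
    by rewrite lerXn2r // nnegrE // !mulr_ge0.
  lra.
lra.
Qed.

End log_expansion.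

Section nonneg_integral.
Context {R : realType} d (T : measurableType d) (P : probability T R).
Implicit Types f g : T -> R.

Lemma ge0_integral_fctD f g : measurable_fun setT f -> measurable_fun setT g ->
  (forall x, 0 <= f x) -> (forall x, 0 <= g x) ->
  (\int[P]_x (f x + g x)%:E = \int[P]_x (f x)%:E + \int[P]_x (g x)%:E)%E.
Proof.
move=> mf mg f0 g0; under eq_integral do rewrite EFinD.
by rewrite ge0_integralD //; first [exact/measurable_EFinP|move=> x _; rewrite lee_fin].
Qed.

Lemma ge0_integral_fctZ c f : measurable_fun setT f -> (forall x, 0 <= f x) ->
  0 <= c -> (\int[P]_x (c * f x)%:E = c%:E * \int[P]_x (f x)%:E)%E.
Proof.
move=> mf f0 c0; under eq_integral do rewrite EFinM.
by rewrite ge0_integralZl //; first [exact/measurable_EFinP|move=> x _; rewrite lee_fin].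
Qed.

Lemma ge0_integral_fct_sum m (f : 'I_m -> T -> R) :
  (forall j, measurable_fun setT (f j)) -> (forall j x, 0 <= f j x) ->
  (\int[P]_x (\sum_(j < m) f j x)%:E = \sum_(j < m) \int[P]_x (f j x)%:E)%E.
Proof.
move=> mf f0; under eq_integral do rewrite -sumEFin.
rewrite ge0_integral_sum // => j; first exact/measurable_EFinP.
by move=> x _; rewrite lee_fin.
Qed.

Lemma ge0_le_integral_fct f g : measurable_fun setT f -> measurable_fun setT g ->
  (forall x, 0 <= f x) -> (forall x, f x <= g x) ->
  (\int[P]_x (f x)%:E <= \int[P]_x (g x)%:E)%E.
Proof.
move=> mf mg f0 fg; apply: ge0_le_integral => //.
- by move=> x _; rewrite lee_fin.
- exact/measurable_EFinP.
- exact/measurable_EFinP.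
- by move=> x _; rewrite lee_fin.
Qed.

End nonneg_integral.

Section heat_mean.
Context {R : realType}.
Local Notation gauss := (@gauss R).
Local Notation M := (2 * expR (9 / 2) : R).
Implicit Types (U : R -> R).

(* Stands in for a bound on the first two derivatives of [U]. *)
Definition unif_diff K U := forall x : R, exists2 D : R, `|D| <= K &
  forall y, `|U (x + y) - U x - D * y| <= K * y ^+ 2.

Lemma sqr_le_expw (x : R) : x ^+ 2 <= expw x.
Proof.
apply: le_trans (expw_ge_cube x); rewrite -(real_normK (num_real x)).
have x0 := normr_ge0 x; set t := `|x| in x0 *.
have -> : (1 + t) ^+ 3 = t ^+ 2 + (1 + 3 * t + 2 * t ^+ 2 + t ^+ 3) by ring.
by rewrite lerDl !addr_ge0 ?mulr_ge0 ?exprn_ge0.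
Qed.

(** Averaging over [y] and [- y] cancels the linear term, so the error is of order [a ^+ 2] and not
    merely [a]. *)
Lemma heat_sub_le K b B U a x : 0 <= K -> measurable_fun setT U -> 0 <= b ->
  (forall x, b <= U x <= B) -> unif_diff K U ->
  `|heat U a x - U x| <= K * a ^+ 2 * M.
Proof.
move=> K0 mU b0 Ub /(_ x)[D _ UD].
have i1 s := integrable_heat mU b0 Ub s x.
have heatN : heat U (- a) x = heat U a x.
  rewrite /heat /Rintegral -(gauss_even (f := fun y => (U (x + a * y))%:E)).
  - by congr fine; apply: eq_integral => y _; rewrite mulNr mulrN.
  - by apply/measurable_EFinP; exact: measurable_shift_scale.
  - by move=> y; rewrite lee_fin; have /andP[+ _] := Ub (x + a * y); exact: le_trans.
pose h y := U (x + a * y) + U (x + - a * y) - (U x + U x).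
have hle y : `|h y| <= 2 * K * a ^+ 2 * expw y.
  have h1 := UD (a * y); have h2 := UD (- a * y).
  rewrite mulNr sqrrN in h2.
  rewrite (_ : h y = (U (x + a * y) - U x - D * (a * y)) +
    (U (x + - (a * y)) - U x - D * - (a * y))); last by rewrite /h mulNr; ring.
  rewrite (le_trans (ler_normD _ _)) // (le_trans (lerD h1 h2)) //.
  have : K * (a * y) ^+ 2 <= K * a ^+ 2 * expw y.
    rewrite exprMn mulrA; apply: ler_wpM2l; last exact: sqr_le_expw.
    by apply: mulr_ge0 => //; exact: sqr_ge0.
  lra.
have mh : measurable_fun setT h.
  by apply: measurable_funB => //; apply: measurable_funD; exact: measurable_shift_scale.
have ci : gauss.-integrable setT (EFin \o (fun=> U x + U x)).
  apply: (integrable_expw (C := `|U x + U x|)) => // y.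
  by rewrite ler_peMr // (le_trans _ (expw_ge_norm _)) // lerDl.
have := normr_Rintegral_expw mh hle.
rewrite /h RintegralB //; last first.
  have := integrableD measurableT (i1 a) (i1 (- a)).
  by under [X in integrable _ _ X -> _]eq_fun do rewrite /= -EFinD.
rewrite RintegralD // -/(heat U a x) -/(heat U (- a) x) heatN.
rewrite Rintegral_cst // [X in fine X]probability_setT mulr1.
rewrite (_ : _ - _ = 2 * (heat U a x - U x)); last by ring.
rewrite normrM ger0_norm // -!mulrA ler_pM2l ?ltr0n //.
Qed.

End heat_mean.

Section weight.
Context {R : realType}.

(** One factor 4 per summand, from [4 (u^3 + t^3) - (u + t)^3 = 3 (u + t) (u - t)^2]. *)
Lemma cube_sum_le m (y : 'I_m -> R) : (forall j, 0 <= y j) ->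
  (1 + \sum_(j < m) y j) ^+ 3 <= 4 ^+ m * (1 + \sum_(j < m) y j ^+ 3).
Proof.
elim: m y => [|m IH] y y0; first by rewrite !big_ord0 !addr0 expr1n expr0 mul1r.
rewrite !big_ord_recr /= !addrA.
set s := \sum_(j < m) _; set s3 := \sum_(j < m) _ ^+ 3; set t := y ord_max.
have t0 : 0 <= t by exact: y0.
have s0 : 0 <= s by apply: sumr_ge0 => j _; exact: y0.
have s30 : 0 <= s3 by apply: sumr_ge0 => j _; rewrite exprn_ge0.
have H : (1 + s + t) ^+ 3 <= 4 * ((1 + s) ^+ 3 + t ^+ 3).
  set u := 1 + s; have u0 : 0 <= u by rewrite /u addr_ge0.
  rewrite -subr_ge0.
  have -> : 4 * (u ^+ 3 + t ^+ 3) - (u + t) ^+ 3 = 3 * ((u + t) * (u - t) ^+ 2).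
    by ring.
  by apply: mulr_ge0 => //; apply: mulr_ge0; [exact: addr_ge0|exact: sqr_ge0].
rewrite (le_trans H) // [4 ^+ m.+1]exprS -[leRHS]mulrA ler_pM2l ?ltr0n // mulrDr lerD //.
  exact: (IH (fun j => y (widen_ord (leqnSn m) j))).
by rewrite ler_peMl ?exprn_ge0 // exprn_ege1 // ler1n.
Qed.

(** A single weight above every [1 + |dot (A j) z|], so that one radius [r = a * dotw A z] bounds
    the increments of all factors at once. *)
Definition dotw m k (A : 'I_m -> 'I_k -> R) (z : k.-tuple R) : R :=
  1 + \sum_(j < m) `|dot (A j) z|.

Lemma measurable_dotw m k (A : 'I_m -> 'I_k -> R) : measurable_fun setT (dotw A).
Proof.
apply: measurable_funD => //; apply: measurable_sum => j.
by apply: measurableT_comp => //; exact: measurable_dot.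
Qed.

Lemma dotw_ge m k (A : 'I_m -> 'I_k -> R) z j : 1 + `|dot (A j) z| <= dotw A z.
Proof.
rewrite /dotw lerD2l (bigD1 j) //= lerDl; apply: sumr_ge0 => i _.
exact: normr_ge0.
Qed.

Lemma dotw_ge1 m k (A : 'I_m -> 'I_k -> R) z : 1 <= dotw A z.
Proof. by rewrite /dotw lerDl; apply: sumr_ge0. Qed.

Lemma integral_dotw3 m k (A : 'I_m -> 'I_k -> R) :
  (forall j, \sum_(l < k) A j l ^+ 2 = 1) ->
  exists2 W : R, 0 <= W & (\int[std_gaussian k]_z (dotw A z ^+ 3)%:E <= W%:E)%E.
Proof.
move=> A1; exists (4 ^+ m * (1 + \sum_(j < m) (2 * expR (9 / 2)))).
  rewrite mulr_ge0 ?exprn_ge0 // addr_ge0 //; apply: sumr_ge0 => j _.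
  by rewrite mulr_ge0 ?expR_ge0.
have me j : measurable_fun setT (fun z : k.-tuple R => expw (dot (A j) z)).
  apply: measurableT_comp; first exact: measurable_expw.
  exact: measurable_dot.
have ms : measurable_fun setT (fun z : k.-tuple R => \sum_(j < m) expw (dot (A j) z)).
  by apply: measurable_sum.
have s0 z : 0 <= \sum_(j < m) expw (dot (A j) z).
  by apply: sumr_ge0 => j _; exact: expw_ge0.
apply: (@le_trans _ _ (\int[std_gaussian k]_z (4 ^+ m *
    (1 + \sum_(j < m) expw (dot (A j) z)))%:E)%E).
  apply: ge0_le_integral_fct.
  - by apply: measurable_funX; exact: measurable_dotw.
  - by apply: measurable_funM => //; apply: measurable_funD.
  - by move=> z; rewrite exprn_ge0 // (le_trans ler01) // dotw_ge1.
  - move=> z; rewrite (le_trans (cube_sum_le _)) // ler_wpM2l ?exprn_ge0 // lerD2l.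
    rewrite ler_sum // => j _; apply: le_trans (expw_ge_cube _).
    by rewrite lerXn2r ?nnegrE ?addr_ge0 // lerDr.
rewrite ge0_integral_fctZ ?exprn_ge0 //; last 2 first.
- exact: measurable_funD.
- by move=> z; rewrite addr_ge0.
rewrite ge0_integral_fctD // integral_prob_cst ge0_integral_fct_sum //; last first.
  by move=> j z; exact: expw_ge0.
rewrite EFinM lee_pmul2l ?lte_fin ?exprn_gt0 //.
rewrite EFinD leeD2l // -sumEFin lee_sum // => j _.
rewrite (std_gaussian_dot (s := 1) (f := fun x => (expw x)%:E)); last 3 first.
- by rewrite A1 expr1n.
- by apply/measurable_EFinP; exact: measurable_expw.
- by move=> x; rewrite lee_fin expw_ge0.
by under eq_integral do rewrite mul1r; rewrite integral_expw.
Qed.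

End weight.

(** * One step of the flow *)

Section one_step.
Context {R : realType}.
Local Notation gauss := (@gauss R).
Local Notation M := (2 * expR (9 / 2) : R).

(** The second moment stays abstract: in [heat_flow_step] it is a common factor of the two quadratic
    terms being compared. *)
Lemma gauss_moment2 : exists2 v : R, 0 <= v & (\int[gauss]_x (x ^+ 2)%:E = v%:E)%E.
Proof.
have m2 : measurable_fun [set: R] (fun x => x ^+ 2) by exact: measurable_funX.
have le : (\int[gauss]_x (x ^+ 2)%:E <= (2 * expR (9 / 2))%:E)%E.
  rewrite -integral_expw; apply: ge0_le_integral_fct => //.
  - exact: measurable_expw.
  - by move=> x; exact: sqr_ge0.
  - exact: sqr_le_expw.
have ge : (0 <= \int[gauss]_x (x ^+ 2)%:E)%E.
  by apply: integral_ge0 => x _; rewrite lee_fin sqr_ge0.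
exists (fine (\int[gauss]_x (x ^+ 2)%:E)%E); first exact: fine_ge0.
by rewrite fineK // ge0_fin_numE // (le_lt_trans le) // ltry.
Qed.

Lemma integral_dot2 k (a : 'I_k -> R) v : (\int[gauss]_x (x ^+ 2)%:E = v%:E)%E ->
  (\int[std_gaussian k]_z (dot a z ^+ 2)%:E = ((\sum_(l < k) a l ^+ 2) * v)%:E)%E.
Proof.
move=> gv; pose s := Num.sqrt (\sum_(l < k) a l ^+ 2).
have sE : s ^+ 2 = \sum_(l < k) a l ^+ 2.
  by rewrite sqr_sqrtr // sumr_ge0 // => l _; exact: sqr_ge0.
rewrite (std_gaussian_dot (f := fun x => (x ^+ 2)%:E) sE); last 2 first.
- by apply/measurable_EFinP; exact: measurable_funX.
- by move=> x; rewrite lee_fin sqr_ge0.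
under eq_integral do rewrite exprMn.
rewrite (@ge0_integral_fctZ _ _ _ _ _ (fun x : R => x ^+ 2)).
- by rewrite gv -sE EFinM.
- exact: measurable_funX.
- by move=> x; exact: sqr_ge0.
- exact: sqr_ge0.
Qed.

Lemma prod_powR_quotient m (c q u : 'I_m -> R) :
  (forall j, 0 < q j) -> (forall j, 0 < u j) ->
  \prod_(j < m) q j `^ c j =
  (\prod_(j < m) u j `^ c j) * expR (\sum_(j < m) c j * ln (q j / u j)).
Proof.
move=> q0 u0; rewrite expR_sum -big_split /=; apply: eq_bigr => j _.
rewrite /powR !gt_eqF // -expRD; congr expR.
by rewrite ln_div ?posrE //; ring.
Qed.

(** The quotient is taken against the mean [u], whereas the Taylor expansion is centred at [U x]; by
    [heat_sub_le] the discrepancy is of order [a ^+ 2], hence harmless. In the constant, [2 * K + B]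
    is a Lipschitz bound, [K * M] pays for [u - U x], the last [K] for the linear or quadratic
    Taylor term, and [dl] for dividing by [u]. *)
Lemma step_remainders (dl B K : R) : 0 < dl -> dl <= B -> 0 <= K ->
  exists2 C : R, 0 <= C &
  forall (U : R -> R) (x a y D w : R),
  measurable_fun setT U -> (forall x, dl <= U x <= B) -> unif_diff K U ->
  0 <= a <= 1 -> `|D| <= K ->
  (forall y, `|U (x + y) - U x - D * y| <= K * y ^+ 2) ->
  1 + `|y| <= w ->
  let u := heat U a x in let p := U (x + a * y) / u - 1 in
  let b := D / u * (a * y) in let r := a * w in
  [/\ `|p| <= C * r, `|b| <= C * r & `|p - b| <= C * r ^+ 2].
Proof.
move=> dl0 dlB K0.
have M0 : 0 <= M by rewrite mulr_ge0 ?expR_ge0.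
have B0 : 0 <= B by rewrite ltW // (lt_le_trans dl0).
exists ((2 * K + B + K * M + K) / dl).
  by rewrite divr_ge0 ?(ltW dl0) // !addr_ge0 // mulr_ge0.
move=> U x a y D w mU Ub HU /andP[a0 a1] DK UD yw u p b r.
have /andP[u1 u2] : dl <= u <= B by exact: heat_bounds (ltW dl0) Ub _ _.
have u0 : 0 < u by exact: lt_le_trans u1.
have uV : u^-1 <= dl^-1 by rewrite lef_pV2.
have uUx : `|u - U x| <= K * a ^+ 2 * M by exact: heat_sub_le (ltW dl0) Ub HU.
have y0 := normr_ge0 y.
have w1 : 1 <= w by lra.
have w0 : 0 <= w by lra.
have yw' : `|y| <= w by lra.
have r0 : 0 <= r by rewrite mulr_ge0.
have ar : a <= r by rewrite ler_peMr.
have ayr : `|a * y| <= r by rewrite normrM (ger0_norm a0) ler_wpM2l.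
have a2r2 : a ^+ 2 <= r ^+ 2 by rewrite lerXn2r ?nnegrE.
have ay2 : (a * y) ^+ 2 <= r ^+ 2.
  by rewrite -(real_normK (num_real (a * y))) lerXn2r ?nnegrE.
have div_le (t X : R) : `|t| <= X -> `|t / u| <= X / dl.
  move=> tX; rewrite normrM (gtr0_norm (_ : 0 < u^-1)) ?invr_gt0 //.
  by rewrite ler_pM // invr_ge0 ltW.
have fin (t X Y : R) : 0 <= Y -> `|t| <= X * Y -> X <= 2 * K + B + K * M + K ->
    `|t / u| <= (2 * K + B + K * M + K) / dl * Y.
  move=> Y0 tX XC; rewrite mulrAC; apply: div_le; apply: (le_trans tX).
  by rewrite ler_wpM2r.
have KM0 : 0 <= K * M by rewrite mulr_ge0.
have pE : p = (U (x + a * y) - u) / u by rewrite /p mulrBl divff ?gt_eqF.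
have bE : b = (D * (a * y)) / u by rewrite /b mulrAC.
(* Small increments use the Taylor bound; for large ones [r >= 1], and the oscillation of [U] is at
   most [B]. *)
have Lip : `|U (x + a * y) - U x| <= (2 * K + B) * r.
  have [ay1|ay1] := leP `|a * y| 1.
    rewrite (_ : _ - _ = (U (x + a * y) - U x - D * (a * y)) + D * (a * y)); last by ring.
    rewrite (le_trans (ler_normD _ _)) //.
    have h1 := UD (a * y).
    have h2 : K * (a * y) ^+ 2 <= K * r.
      rewrite ler_wpM2l // (le_trans _ ayr) // -(real_normK (num_real (a * y))).
      by rewrite expr2 ler_piMl.
    have h3 : `|D * (a * y)| <= K * r by rewrite normrM ler_pM.
    have := mulr_ge0 B0 r0; lra.
  have /andP[h1 h2] := Ub (x + a * y); have /andP[h3 h4] := Ub x.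
  rewrite (le_trans (ler_norm_sub_bounds (ltW dl0) h1 h2 h3 h4)) //.
  have r1 : 1 <= r by rewrite (le_trans (ltW ay1)).
  by rewrite (@le_trans _ _ (B * r)) ?ler_peMr // ler_wpM2r // lerDr mulr_ge0.
split.
- rewrite pE; apply: (fin _ (2 * K + B + K * M)) => //; last by rewrite lerDl.
  rewrite (_ : _ - u = (U (x + a * y) - U x) - (u - U x)); last by ring.
  rewrite (le_trans (ler_normB _ _)) // [leRHS]mulrDl lerD // (le_trans uUx) //.
  rewrite mulrAC ler_wpM2l //.
  by rewrite (le_trans _ ar) // expr2 ler_piMl.
- rewrite bE; apply: (fin _ K) => //; last by rewrite lerDr !addr_ge0 // mulr_ge0.
  by rewrite normrM ler_pM.
- rewrite pE bE -mulrBl; apply: (fin _ (K + K * M)); rewrite ?sqr_ge0 //.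
    rewrite (_ : _ - u - _ = (U (x + a * y) - U x - D * (a * y)) - (u - U x)); last by ring.
    rewrite (le_trans (ler_normB _ _)) // [leRHS]mulrDl lerD //.
      by rewrite (le_trans (UD _)) // ler_wpM2l.
    by rewrite (le_trans uUx) // mulrAC ler_wpM2l.
  lra.
Qed.

(** Factoring out the means [u j] leaves the expectation of [expR (T z)], bounded by integrating the
    pointwise inequality [key]. Its first-order terms have mean zero, [Adom] compares its quadratic
    terms, and only the cubic remainder survives. The constant depends on [dl], [B], [K], [A] and
    [c], not on [U], [x] or [a], so the step can be iterated. *)
Lemma heat_flow_step m k (A : 'I_m -> 'I_k -> R) (c : 'I_m -> R) (dl B K : R) :
  (forall j, \sum_(l < k) A j l ^+ 2 = 1) -> (forall j, 0 <= c j) ->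
  (forall D : 'I_m -> R, \sum_(l < k) (\sum_(j < m) c j * D j * A j l) ^+ 2 <=
     \sum_(j < m) c j * D j ^+ 2) ->
  0 < dl -> dl <= B -> 0 <= K -> exists2 C : R, 0 <= C &
  forall (U : 'I_m -> R -> R) (x : 'I_m -> R) (a : R),
  (forall j, measurable_fun setT (U j)) -> (forall j x, dl <= U j x <= B) ->
  (forall j, unif_diff K (U j)) -> 0 <= a <= 1 ->
  (\int[std_gaussian k]_z (\prod_(j < m) U j (x j + a * dot (A j) z)%R `^ c j)%:E <=
   (\prod_(j < m) heat (U j) a (x j) `^ c j + C * a ^+ 3)%:E)%E.
Proof.
move=> A1 c0 Adom dl0 dlB K0.
have B0 : 0 < B by exact: lt_le_trans dlB.
have [C1 C10 H1] := ln_quotient_expansion dl0 dlB.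
have [C2 C20 H2] := step_remainders dl0 dlB K0.
pose C := C1 + C1 * C2 + C1 * C2 ^+ 2 + C1 * C2 ^+ 3 + C2.
have C12 : 0 <= C1 * C2 by rewrite mulr_ge0.
have C122 : 0 <= C1 * C2 ^+ 2 by rewrite mulr_ge0 ?exprn_ge0.
have C123 : 0 <= C1 * C2 ^+ 3 by rewrite mulr_ge0 ?exprn_ge0.
have C0 : 0 <= C by rewrite /C; lra.
have [C3 C30 H3] := expR_wsum_expansion c0 C0.
have [W W0 HW] := integral_dotw3 A1.
have [v2 v20 Hv2] := gauss_moment2.
pose PB := \prod_(j < m) B `^ c j.
exists (PB * (C3 * W)).
  by rewrite !mulr_ge0 //; apply: prodr_ge0 => j _; exact: powR_ge0.
move=> U x a mU Ub HU a01; have /andP[a0 a1] := a01.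
have /choice[D HD] : forall j, exists D : R, `|D| <= K /\
    forall y, `|U j (x j + y) - U j (x j) - D * y| <= K * y ^+ 2.
  by move=> j; have [D h1 h2] := HU j (x j); exists D.
pose u j := heat (U j) a (x j).
have ub j : dl <= u j <= B by exact: heat_bounds (mU j) (ltW dl0) (Ub j) _ _.
have u0 j : 0 < u j by have /andP[+ _] := ub j; exact: lt_le_trans.
pose q j (z : k.-tuple R) := U j (x j + a * dot (A j) z).
have q0 j z : 0 < q j z by have /andP[+ _] := Ub j (x j + a * dot (A j) z); exact: lt_le_trans.
have mq j : measurable_fun setT (q j).
  apply: measurableT_comp => //; apply: measurable_funD => //.
  by apply: measurable_funM => //; exact: measurable_dot.
pose beta j := D j / u j.
pose T z := \sum_(j < m) c j * ln (q j z / u j).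
have mT : measurable_fun setT T.
  apply: measurable_sum => j; apply: measurable_funM => //.
  by apply: measurableT_comp => //; exact: measurable_funM.
(* The vector [sum_j c_j a beta_j A_j]: its linear form is the weighted sum of the linear
   increments, and its squared norm is the left-hand side of [Adom] for [D j = a * beta j]. *)
pose bb l := \sum_(j < m) c j * (a * beta j) * A j l.
have bbE z : dot bb z = \sum_(j < m) c j * (beta j * (a * dot (A j) z)).
  rewrite /dot /bb; under eq_bigr do rewrite mulr_suml.
  rewrite exchange_big; apply: eq_bigr => j _ /=.
  by rewrite !mulr_sumr; apply: eq_bigr => l _; ring.
pose F2 z := \sum_(j < m) (2^-1 * c j * beta j ^+ 2 * a ^+ 2) * dot (A j) z ^+ 2.
pose G2 z := \sum_(j < m) (c j / u j) * q j z.
(* The two sides of [P >= Sigma] are kept on opposite sides so that all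
   integrands are nonnegative. *)
have key z : expR (T z) + (\sum_(j < m) c j + F2 z) <=
    1 + (G2 z + (2^-1 * dot bb z ^+ 2 + C3 * a ^+ 3 * dotw A z ^+ 3)).
  have w1 := dotw_ge1 A z.
  have r0 : 0 <= a * dotw A z by rewrite mulr_ge0 // (le_trans ler01).
  have HH j := H2 (U j) (x j) a (dot (A j) z) (D j) (dotw A z) (mU j) (Ub j)
    (HU j) a01 (HD j).1 (HD j).2 (dotw_ge A z j).
  have LL j : [/\ `|ln (q j z / u j)| <= C, `|ln (q j z / u j)| <= C * (a * dotw A z),
      `|ln (q j z / u j) - (q j z / u j - 1)| <= C * (a * dotw A z) ^+ 2 &
      `|ln (q j z / u j) - ((q j z / u j - 1) - (q j z / u j - 1) ^+ 2 / 2)| <=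
        C * (a * dotw A z) ^+ 3].
    have [h _ _] := HH j.
    have [g1 g2 g3 g4] := H1 _ _ _ (Ub j (x j + a * dot (A j) z)) (ub j) h.
    split.
    - by rewrite (le_trans g1) // /C; lra.
    - by rewrite (le_trans g2) // mulrA ler_wpM2r // /C; lra.
    - by rewrite (le_trans g3) // exprMn mulrA ler_wpM2r ?exprn_ge0 // /C; lra.
    - by rewrite (le_trans g4) // exprMn mulrA ler_wpM2r ?exprn_ge0 // /C; lra.
  have C2C : C2 <= C by rewrite /C; lra.
  have e1 j : `|q j z / u j - 1| <= C * (a * dotw A z).
    by have [h _ _] := HH j; rewrite (le_trans h) // ler_wpM2r.
  have e2 j : `|beta j * (a * dot (A j) z)| <= C * (a * dotw A z).
    by have [_ h _] := HH j; rewrite (le_trans h) // ler_wpM2r.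
  have e3 j : `|q j z / u j - 1 - beta j * (a * dot (A j) z)| <= C * (a * dotw A z) ^+ 2.
    by have [_ _ h] := HH j; rewrite (le_trans h) // ler_wpM2r // sqr_ge0.
  have := H3 (fun j => ln (q j z / u j)) (fun j => q j z / u j - 1)
    (fun j => beta j * (a * dot (A j) z)) _ r0
    (fun j => let: And4 h _ _ _ := LL j in h) (fun j => let: And4 _ h _ _ := LL j in h)
    (fun j => let: And4 _ _ h _ := LL j in h) (fun j => let: And4 _ _ _ h := LL j in h) e1 e2 e3.
  rewrite -/(T z) -bbE.
  have -> : \sum_(j < m) c j * (q j z / u j - 1) = G2 z - \sum_(j < m) c j.
    by rewrite /G2 -sumrB; apply: eq_bigr => j _; field; rewrite gt_eqF.
  have -> : 2^-1 * \sum_(j < m) c j * (beta j * (a * dot (A j) z)) ^+ 2 = F2 z.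
    by rewrite /F2 mulr_sumr; apply: eq_bigr => j _; ring.
  rewrite exprMn; lra.
have F20 z : 0 <= F2 z.
  apply: sumr_ge0 => j _.
  by rewrite mulr_ge0 ?sqr_ge0 // mulr_ge0 ?sqr_ge0 // mulr_ge0 ?sqr_ge0 // mulr_ge0.
have G20 z : 0 <= G2 z.
  by apply: sumr_ge0 => j _; rewrite mulr_ge0 ?(ltW (q0 _ _)) // divr_ge0 // ltW.
have mF2 : measurable_fun setT F2.
  apply: measurable_sum => j; apply: measurable_funM => //.
  by apply: measurable_funX; exact: measurable_dot.
have mG2 : measurable_fun setT G2.
  by apply: measurable_sum => j; exact: measurable_funM.
have meT : measurable_fun setT (fun z => expR (T z)) by exact: measurableT_comp.
have mbb : measurable_fun setT (fun z : k.-tuple R => 2^-1 * dot bb z ^+ 2).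
  by apply: measurable_funM => //; apply: measurable_funX; exact: measurable_dot.
have mw : measurable_fun setT (fun z : k.-tuple R => C3 * a ^+ 3 * dotw A z ^+ 3).
  by apply: measurable_funM => //; apply: measurable_funX; exact: measurable_dotw.
have w0 z : 0 <= dotw A z ^+ 3 by rewrite exprn_ge0 // (le_trans ler01) // dotw_ge1.
have Ca0 : 0 <= C3 * a ^+ 3 by rewrite mulr_ge0 // exprn_ge0.
have Sc0 : 0 <= \sum_(j < m) c j by exact: sumr_ge0.
have IF2 : (\int[std_gaussian k]_z (F2 z)%:E =
    (\sum_(j < m) 2^-1 * c j * beta j ^+ 2 * a ^+ 2 * v2)%:E)%E.
  rewrite ge0_integral_fct_sum.
  - rewrite -sumEFin; apply: eq_bigr => j _.
    rewrite (@ge0_integral_fctZ _ _ _ _ _ (fun z => dot (A j) z ^+ 2)).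
    + by rewrite (integral_dot2 _ Hv2) A1 mul1r -EFinM.
    + by apply: measurable_funX; exact: measurable_dot.
    + by move=> z; exact: sqr_ge0.
    + by rewrite mulr_ge0 ?sqr_ge0 // mulr_ge0 ?sqr_ge0 // mulr_ge0.
  - move=> j; apply: measurable_funM => //.
    by apply: measurable_funX; exact: measurable_dot.
  - by move=> j z; rewrite mulr_ge0 ?sqr_ge0 // mulr_ge0 ?sqr_ge0 // mulr_ge0 ?sqr_ge0 // mulr_ge0.
(* Each [q j / u j] has mean 1, because [dot (A j) z] is standard Gaussian and [u j] is the
   corresponding average. *)
have IG2 : (\int[std_gaussian k]_z (G2 z)%:E = (\sum_(j < m) c j)%:E)%E.
  rewrite ge0_integral_fct_sum.
  - rewrite -sumEFin; apply: eq_bigr => j _.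
    rewrite ge0_integral_fctZ //.
    + rewrite (std_gaussian_dot (s := 1) (f := fun y => (U j (x j + a * y))%:E)).
      * under eq_integral do rewrite mul1r.
        rewrite -(EFin_heat (mU j) (ltW dl0) (Ub j)) -/(u j) -EFinM; congr EFin.
        by field; rewrite gt_eqF.
      * by rewrite A1 expr1n.
      * by apply/measurable_EFinP; exact: measurable_shift_scale.
      * by move=> y; rewrite lee_fin; have /andP[+ _] := Ub j (x j + a * y); apply: le_trans; exact: ltW.
    + by move=> z; exact: ltW.
    + by rewrite divr_ge0 // ltW.
  - by move=> j; exact: measurable_funM.
  - by move=> j z; rewrite mulr_ge0 ?(ltW (q0 _ _)) // divr_ge0 // ltW.
have Ibb : (\int[std_gaussian k]_z (2^-1 * dot bb z ^+ 2)%:E <=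
    (\sum_(j < m) 2^-1 * c j * beta j ^+ 2 * a ^+ 2 * v2)%:E)%E.
  rewrite (@ge0_integral_fctZ _ _ _ _ _ (fun z => dot bb z ^+ 2)) ?sqr_ge0 //; last 2 first.
  - by apply: measurable_funX; exact: measurable_dot.
  - by move=> z; exact: sqr_ge0.
  rewrite (integral_dot2 _ Hv2) -EFinM lee_fin.
  have := Adom (fun j => a * beta j).
  rewrite -/bb => H; rewrite mulrA -mulr_suml ler_wpM2r //.
  rewrite (le_trans (ler_wpM2l _ H)) // mulr_sumr ler_sum // => j _.
  by rewrite le_eqVlt; apply/orP; left; apply/eqP; ring.
have Iw : (\int[std_gaussian k]_z (C3 * a ^+ 3 * dotw A z ^+ 3)%:E <=
    (C3 * a ^+ 3 * W)%:E)%E.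
  rewrite (@ge0_integral_fctZ _ _ _ _ _ (fun z => dotw A z ^+ 3)) //; last first.
    by apply: measurable_funX; exact: measurable_dotw.
  by rewrite [leRHS]EFinM lee_wpmul2l // lee_fin.
have IeT : (\int[std_gaussian k]_z (expR (T z))%:E <= (1 + C3 * a ^+ 3 * W)%:E)%E.
  set E2 := \sum_(j < m) 2^-1 * c j * beta j ^+ 2 * a ^+ 2 * v2 in IF2 Ibb.
  have : (\int[std_gaussian k]_z (expR (T z))%:E + (\sum_(j < m) c j + E2)%:E <=
     (1 + (\sum_(j < m) c j + (E2 + C3 * a ^+ 3 * W)))%:E)%E.
    have L : (\int[std_gaussian k]_z (expR (T z))%:E + (\sum_(j < m) c j + E2)%:E =
      \int[std_gaussian k]_z (expR (T z) + (\sum_(j < m) c j + F2 z))%:E)%E.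
      have eT0 z : 0 <= expR (T z) by exact: expR_ge0.
      have sF0 z : 0 <= \sum_(j < m) c j + F2 z by exact: addr_ge0.
      have msF : measurable_fun setT (fun z => \sum_(j < m) c j + F2 z).
        exact: measurable_funD.
      rewrite ge0_integral_fctD // ge0_integral_fctD //.
      by rewrite integral_prob_cst IF2 -EFinD.
    rewrite L; apply: (@le_trans _ _ (\int[std_gaussian k]_z
      (1 + (G2 z + (2^-1 * dot bb z ^+ 2 + C3 * a ^+ 3 * dotw A z ^+ 3)))%:E)%E).
      apply: ge0_le_integral_fct => //.
      - by apply: measurable_funD => //; exact: measurable_funD.
      - by do 3 apply: measurable_funD => //.
      - by move=> z; rewrite addr_ge0 ?expR_ge0 // addr_ge0.
    have b0 z : 0 <= 2^-1 * dot bb z ^+ 2 by rewrite mulr_ge0 ?sqr_ge0.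
    have Cw0 z : 0 <= C3 * a ^+ 3 * dotw A z ^+ 3 by rewrite mulr_ge0.
    have bw0 z : 0 <= 2^-1 * dot bb z ^+ 2 + C3 * a ^+ 3 * dotw A z ^+ 3 by rewrite addr_ge0.
    have mbw := measurable_funD mbb mw.
    rewrite ge0_integral_fctD //; last 2 first.
    - exact: measurable_funD.
    - by move=> z; rewrite addr_ge0.
    rewrite integral_prob_cst EFinD leeD2l // ge0_integral_fctD // IG2.
    rewrite EFinD leeD2l // ge0_integral_fctD // EFinD leeD //.
  (* Cancelling the common finite term needs a finite left-hand integral; the value [+oo]
     contradicts the bound itself. *)
  case: (\int[std_gaussian k]_z (expR (T z))%:E)%E => [r||] //=.
    by rewrite -EFinD !lee_fin; lra.
  by move=> _; exact: leNye.
have P0 : 0 <= \prod_(j < m) u j `^ c j.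
  by apply: prodr_ge0 => j _; exact: powR_ge0.
have -> : (\int[std_gaussian k]_z (\prod_(j < m) U j (x j + a * dot (A j) z)%R `^ c j)%:E =
  \int[std_gaussian k]_z ((\prod_(j < m) u j `^ c j) * expR (T z))%:E)%E.
  by apply: eq_integral => z _; rewrite (prod_powR_quotient c (q0 ^~ z) u0).
rewrite ge0_integral_fctZ //.
have P0E : (0 <= (\prod_(j < m) u j `^ c j)%:E)%E by rewrite lee_fin.
apply: (le_trans (lee_wpmul2l P0E IeT)).
rewrite -EFinM lee_fin mulrDr mulr1 lerD2l.
rewrite (_ : C3 * a ^+ 3 * W = C3 * W * a ^+ 3); last by ring.
rewrite -[leRHS]mulrA; apply: ler_wpM2r.
  by rewrite !mulr_ge0 ?exprn_ge0.
apply: ler_prod => j _; rewrite powR_ge0 /= ge0_ler_powR ?nnegrE //.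
- exact: ltW.
- exact: ltW.
- by have /andP[] := ub j.
Qed.

End one_step.

Lemma lee_EFin_chain (R : realType) (x y : \bar R) (p q : R) :
  (x <= y + p%:E -> x + q%:E <= y + (p + q)%:E)%E.
Proof. by move=> xy; rewrite EFinD addeA leeD2r. Qed.

(** * The Gaussian Brascamp-Lieb inequality *)

Section heat_flow.
Context {R : realType}.
Local Notation gauss := (@gauss R).
Local Notation M := (2 * expR (9 / 2) : R).

(** [K] depends only on [e] and [B]: both the slope bound and the Taylor constant decrease in [s],
    so their values at [s = e] serve for all larger [s]. *)
Lemma unif_diff_heat (e B : R) : 0 < e -> 0 <= B -> exists2 K : R, 0 <= K &
  forall (g : R -> R) b s, measurable_fun setT g -> 0 <= b ->
  (forall x, b <= g x <= B) -> e <= s -> unif_diff K (heat g s).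
Proof.
move=> e0 B0.
have M0 : 0 <= M by rewrite mulr_ge0 ?expR_ge0.
have K10 : 0 <= B * (expR 1 + 1) * (1 + M) / e ^+ 2.
  apply: divr_ge0; last exact: sqr_ge0.
  apply: mulr_ge0; last exact: addr_ge0.
  by apply: mulr_ge0 => //; apply: addr_ge0 => //; exact: expR_ge0.
have K20 : 0 <= B * M / e by rewrite divr_ge0 ?(ltW e0) // mulr_ge0.
exists (B * (expR 1 + 1) * (1 + M) / e ^+ 2 + B * M / e); first exact: addr_ge0.
move=> g b s mg b0 gb es x; have s0 : 0 < s by exact: lt_le_trans es.
exists (heat_slope g s x).
  rewrite (le_trans (heat_slope_le mg b0 gb x s0)) //.
  rewrite (@le_trans _ _ (B * M / e)) ?lerDr //.
  by rewrite ler_wpM2l ?mulr_ge0 // lef_pV2.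
move=> y; rewrite (le_trans (heat_taylor mg b0 gb x y s0)) //.
rewrite exprMn exprVn [in leLHS]mulrCA mulrC; apply: ler_wpM2r; first exact: sqr_ge0.
rewrite (@le_trans _ _ (B * (expR 1 + 1) * (1 + M) / e ^+ 2)) ?lerDl //.
apply: ler_wpM2l.
  apply: mulr_ge0; last exact: addr_ge0.
  by apply: mulr_ge0 => //; apply: addr_ge0 => //; exact: expR_ge0.
by rewrite lef_pV2 ?posrE ?exprn_gt0 // lerXn2r ?nnegrE ?(ltW e0) ?(ltW s0).
Qed.

Lemma heat_heat (g : R -> R) b B a c s x : measurable_fun setT g -> 0 <= b ->
  (forall x, b <= g x <= B) -> s ^+ 2 = a ^+ 2 + c ^+ 2 ->
  heat (heat g c) a x = heat g s x.
Proof.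
move=> mg b0 gb sac; rewrite [LHS]/heat /Rintegral.
by rewrite (heat_semigroup mg b0 gb x sac).
Qed.

Lemma std_gaussian_stable_dot m k (A : 'I_m -> 'I_k -> R) (F : ('I_m -> R) -> R) a b s :
  s ^+ 2 = a ^+ 2 + b ^+ 2 ->
  measurable_fun setT (fun z : k.-tuple R => F (fun j => dot (A j) z)) ->
  (forall x, 0 <= F x) ->
  (\int[std_gaussian k]_z (F (fun j => s * dot (A j) z))%:E =
   \int[std_gaussian k]_z \int[std_gaussian k]_w
     (F (fun j => a * dot (A j) z + b * dot (A j) w))%:E)%E.
Proof.
move=> sab mF F0; pose G z := (F (fun j => dot (A j) z))%:E.
transitivity (\int[std_gaussian k]_z G (tup_lin s 0 z z))%E.
  apply: eq_integral => z _; rewrite /G; congr (F _)%:E; apply/funext => j.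
  by rewrite dot_lin mul0r addr0.
rewrite -(std_gaussian_stable sab).
- apply: eq_integral => z _; apply: eq_integral => w _; rewrite /G.
  by congr (F _)%:E; apply/funext => j; rewrite dot_lin.
- exact/measurable_EFinP.
- by move=> z; rewrite lee_fin.
Qed.

Section flow.
Variables (m k : nat) (A : 'I_m -> 'I_k -> R) (c : 'I_m -> R) (dl B : R).
Hypotheses (A1 : forall j, \sum_(l < k) A j l ^+ 2 = 1) (c0 : forall j, 0 <= c j)
  (Adom : forall D : 'I_m -> R, \sum_(l < k) (\sum_(j < m) c j * D j * A j l) ^+ 2 <=
     \sum_(j < m) c j * D j ^+ 2) (dl0 : 0 < dl) (dlB : dl <= B).
Variable g : 'I_m -> R -> R.
Hypotheses (mg : forall j, measurable_fun setT (g j))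
  (gb : forall j x, dl <= g j x <= B).

Let B0 : 0 <= B. Proof. exact: le_trans (ltW dl0) dlB. Qed.

Definition flow (s : R) (t : R) : \bar R :=
  (\int[std_gaussian k]_z (\prod_(j < m) heat (g j) s (t * dot (A j) z)%R `^ c j)%:E)%E.

Lemma measurable_flow_integrand s (a : R) (x : 'I_m -> R) : measurable_fun setT
  (fun z : k.-tuple R => \prod_(j < m) heat (g j) s (x j + a * dot (A j) z) `^ c j).
Proof.
apply: measurable_prod => j _.
apply: (measurableT_comp (measurable_powR _)).
apply: measurableT_comp; first exact: measurable_heat (ltW dl0) (gb j) _.
by apply: measurable_funD => //; apply: measurable_funM => //; exact: measurable_dot.
Qed.

(** By stability the Gaussian vector of scale [t'] splits into independent parts of scales [t] and
    [a]. Conditionally on the first, [heat_flow_step] applies to the functions [heat (g j) s'], and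
    the semigroup law turns the resulting averages into [heat (g j) s]. *)
Lemma flow_step (e : R) : 0 < e -> exists2 C : R, 0 <= C &
  forall a s s' t t' : R, e <= s' -> 0 <= a <= 1 ->
  s ^+ 2 = a ^+ 2 + s' ^+ 2 -> t' ^+ 2 = t ^+ 2 + a ^+ 2 ->
  (flow s' t' <= flow s t + (C * a ^+ 3)%:E)%E.
Proof.
move=> e0; have [K K0 HK] := unif_diff_heat e0 B0.
have [C C0 HC] := heat_flow_step A1 c0 Adom dl0 dlB K0.
exists C => // a s s' t t' es a01 sE tE; have /andP[a0 _] := a01.
pose F (x : 'I_m -> R) := \prod_(j < m) heat (g j) s' (x j) `^ c j.
have F0 x : 0 <= F x by apply: prodr_ge0 => j _; exact: powR_ge0.
have mFx (x : 'I_m -> R) r : measurable_fun setT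
    (fun z : k.-tuple R => F (fun j => x j + r * dot (A j) z)).
  exact: measurable_flow_integrand.
have mF : measurable_fun setT (fun z : k.-tuple R => F (fun j => dot (A j) z)).
  rewrite (_ : (fun z => _) = (fun z => F (fun j => (fun=> 0) j + 1 * dot (A j) z))).
    exact: mFx.
  by apply/funext => z; congr F; apply/funext => j; rewrite add0r mul1r.
have -> : flow s' t' = (\int[std_gaussian k]_z \int[std_gaussian k]_w
     (F (fun j => t * dot (A j) z + a * dot (A j) w))%:E)%E.
  exact: std_gaussian_stable_dot tE mF F0.
have Ca0 : 0 <= C * a ^+ 3 by rewrite mulr_ge0 ?exprn_ge0.
pose G (z : k.-tuple R) := \prod_(j < m) heat (g j) s (t * dot (A j) z) `^ c j.
have G0 z : 0 <= G z by apply: prodr_ge0 => j _; exact: powR_ge0.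
have mG : measurable_fun setT G.
  rewrite (_ : G = fun z => \prod_(j < m) heat (g j) s ((fun=> 0) j + t * dot (A j) z) `^ c j).
    exact: measurable_flow_integrand.
  by apply/funext => z; apply: eq_bigr => j _; rewrite add0r.
rewrite -[(C * _)%:E](integral_prob_cst (std_gaussian k)) -ge0_integral_fctD //.
apply: ge0_le_integral => //.
- by move=> z _; apply: integral_ge0 => w _; rewrite lee_fin.
- apply: (@measurable_integral_snd _ _ _ _ _ (std_gaussian k)
    (fun z w => (F (fun j => t * dot (A j) z + a * dot (A j) w))%:E)) => [|z w]; last by rewrite lee_fin.
  apply/measurable_EFinP; apply: measurable_prod => j _.
  apply: (measurableT_comp (measurable_powR _)).
  apply: measurableT_comp; first exact: measurable_heat (ltW dl0) (gb j) _.
  by apply: measurable_funD; apply: measurable_funM => //;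
    apply: measurableT_comp => //; exact: measurable_dot.
- by apply/measurable_EFinP; exact: measurable_funD.
move=> z _; have := HC (fun j => heat (g j) s') (fun j => t * dot (A j) z) a.
have mh j : measurable_fun setT (heat (g j) s').
  exact: measurable_heat (ltW dl0) (gb j) _.
have hb j x : dl <= heat (g j) s' x <= B.
  exact: heat_bounds (ltW dl0) (gb j) _ _.
move=> /(_ mh hb (fun j => HK _ _ _ (mg j) (ltW dl0) (gb j) es) a01) /le_trans; apply.
rewrite lee_fin lerD2r /G le_eqVlt; apply/orP; left; apply/eqP.
by apply: eq_bigr => j _; rewrite (heat_heat _ (mg j) (ltW dl0) (gb j) sE).
Qed.

Lemma flow10 : flow 1 0 = (\prod_(j < m) heat (g j) 1 0 `^ c j)%:E.
Proof.
rewrite /flow -[RHS](integral_prob_cst (std_gaussian k)).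
by apply: eq_integral => z _; congr EFin; apply: eq_bigr => j _; rewrite mul0r.
Qed.

Lemma flow_le (e : R) : 0 < e <= 1 ->
  (flow e (Num.sqrt (1 - e ^+ 2)) <= (\prod_(j < m) heat (g j) 1 0 `^ c j)%:E)%E.
Proof.
move=> /andP[e0 e1]; have [C C0 HC] := flow_step e0.
rewrite -flow10; apply/lee_addgt0Pr => eta eta0.
(* With [a ^+ 2 = h <= 1 / n], the total error [n C a^3 = C a (1 - e^2)] is at most [C a], and this
   [n] makes [C a <= eta]. *)
pose n := Num.bound (C ^+ 2 / eta ^+ 2).
have nP : C ^+ 2 / eta ^+ 2 < n%:R.
  by apply: archi_boundP; rewrite divr_ge0 ?sqr_ge0.
have n0 : 0 < n%:R :> R.
  by apply: le_lt_trans nP; rewrite divr_ge0 ?sqr_ge0.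
have e2 : e ^+ 2 <= 1 by rewrite exprn_ile1 // ltW.
pose h := (1 - e ^+ 2) / n%:R.
have h0 : 0 <= h by rewrite divr_ge0 ?(ltW n0) // subr_ge0.
have nh : n%:R * h = 1 - e ^+ 2 by rewrite /h mulrC divfK // gt_eqF.
pose a := Num.sqrt h.
have aE : a ^+ 2 = h by rewrite sqr_sqrtr.
have a0 : 0 <= a by exact: sqrtr_ge0.
have n1 : 1 <= n%:R :> R by rewrite ler1n -(ltr0n R).
have h1 : h <= n%:R^-1.
  have e20 := sqr_ge0 e; have d1 : 1 - e ^+ 2 <= 1 by lra.
  by apply: ler_piMl => //; rewrite invr_ge0 ltW.
have a1 : a <= 1.
  by rewrite -sqrtr1 ler_sqrt // (le_trans h1) // invf_le1.
have ih_le i : (i <= n)%N -> i%:R * h <= 1 - e ^+ 2.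
  by move=> il; rewrite -nh ler_wpM2r // ler_nat.
have main i : (i <= n)%N -> (flow (Num.sqrt (1 - i%:R * h)) (Num.sqrt (i%:R * h)) <=
    flow 1 0 + (i%:R * (C * a ^+ 3))%:E)%E.
  elim: i => [|i IH] il; first by rewrite !mul0r subr0 sqrtr1 sqrtr0 adde0.
  have le1 := ih_le _ il; have ile := ih_le _ (ltnW il).
  have i0 : 0 <= i%:R * h by rewrite mulr_ge0.
  have i10 : 0 <= i.+1%:R * h by rewrite mulr_ge0.
  have e20 := sqr_ge0 e.
  have sE : Num.sqrt (1 - i%:R * h) ^+ 2 = a ^+ 2 + Num.sqrt (1 - i.+1%:R * h) ^+ 2.
    by rewrite aE !sqr_sqrtr ?subr_ge0 -?natr1; lra.
  have tE : Num.sqrt (i.+1%:R * h) ^+ 2 = Num.sqrt (i%:R * h) ^+ 2 + a ^+ 2.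
    by rewrite aE !sqr_sqrtr // -natr1; ring.
  (* The heat parameter never drops below [e], so the same [C] serves for every step. *)
  have es : e <= Num.sqrt (1 - i.+1%:R * h).
    by rewrite -[e]gtr0_norm // -sqrtr_sqr ler_sqrt; lra.
  have a01 : 0 <= a <= 1 by rewrite a0.
  apply: (le_trans (HC _ _ _ _ _ es a01 sE tE)).
  have -> : i.+1%:R * (C * a ^+ 3) = i%:R * (C * a ^+ 3) + C * a ^+ 3.
    by rewrite -natr1; ring.
  exact: lee_EFin_chain (IH (ltnW il)).
have := main n (leqnn n); rewrite nh opprB addrCA subrr addr0 sqrtr_sqr gtr0_norm //.
move/le_trans; apply; apply: leeD; first exact: lexx.
rewrite lee_fin.
have -> : n%:R * (C * a ^+ 3) = C * a * (n%:R * h) by rewrite -aE; ring.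
have Ca0 : 0 <= C * a by rewrite mulr_ge0.
rewrite nh (@le_trans _ _ (C * a)) // ?ler_piMr // ?lerBlDr ?lerDl ?sqr_ge0 //.
rewrite -(@ler_pXn2r _ 2) ?nnegrE ?(ltW eta0) // exprMn aE.
rewrite (le_trans (ler_wpM2l (sqr_ge0 _) h1)) // ler_pdivrMr // mulrC.
by rewrite -ler_pdivrMr ?exprn_gt0 // ltW.
Qed.

End flow.
End heat_flow.

(** * Removing the cut-off for continuous functions *)

Section continuous_case.
Context {R : realType}.
Local Notation gauss := (@gauss R).

Lemma cvg_powR (u : nat -> R) (l c : R) : 0 < l -> u n @[n --> \oo] --> l ->
  u n `^ c @[n --> \oo] --> l `^ c.
Proof.
move=> l0 ul; apply: (cvg_comp u (fun x => x `^ c) ul).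
suff : {for l, continuous (fun x => x `^ c)} by [].
apply: differentiable_continuous; apply/derivable1_diffP.
by apply: derivable_powR; rewrite in_itv /= l0.
Qed.

Lemma cvg_prodR m (u : 'I_m -> nat -> R) (l : 'I_m -> R) :
  (forall j, u j n @[n --> \oo] --> l j) ->
  \prod_(j < m) u j n @[n --> \oo] --> \prod_(j < m) l j.
Proof.
move=> ul; elim: m u l ul => [|m IH] u l ul.
  by rewrite big_ord0; under eq_fun do rewrite big_ord0; exact: cvg_cst.
rewrite big_ord_recr /=; under eq_fun do rewrite big_ord_recr /=.
by apply: cvgM => //; exact: IH.
Qed.

Lemma bounded_cvg_integral d (T : measurableType d) (P : probability T R)
  (f : nat -> T -> R) (h : T -> R) (B : R) :
  (forall n, measurable_fun setT (f n)) -> measurable_fun setT h ->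
  (forall n x, `|f n x| <= B) -> (forall x, f n x @[n --> \oo] --> h x) ->
  (\int[P]_x (f n x)%:E @[n --> \oo] --> \int[P]_x (h x)%:E)%E.
Proof.
move=> mf mh fB fh.
have [] := @dominated_convergence _ _ _ P _ measurableT (fun n x => (f n x)%:E)
  (fun x => (h x)%:E) (cst B%:E) => //.
- by move=> n; exact/measurable_EFinP.
- exact/measurable_EFinP.
- by apply: aeW => x _; apply: cvg_EFin; [exact: nearW|exact: fh].
- exact: finite_measure_integrable_cst.
- by apply: aeW => x n _; rewrite lee_fin.
Qed.

Section gaussian_bl.
Variables (m k : nat) (A : 'I_m -> 'I_k -> R) (c : 'I_m -> R) (dl B : R).
Hypotheses (A1 : forall j, \sum_(l < k) A j l ^+ 2 = 1) (c0 : forall j, 0 <= c j)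
  (Adom : forall D : 'I_m -> R, \sum_(l < k) (\sum_(j < m) c j * D j * A j l) ^+ 2 <=
     \sum_(j < m) c j * D j ^+ 2) (dl0 : 0 < dl) (dlB : dl <= B).

(** Dominated convergence is used twice: inside, continuity gives pointwise convergence of the heat
    averages to [g j]; outside, the products are bounded by [PB]. *)
Lemma gaussian_bl_continuous (g : 'I_m -> R -> R) :
  (forall j, continuous (g j)) -> (forall j x, dl <= g j x <= B) ->
  (\int[std_gaussian k]_z (\prod_(j < m) g j (dot (A j) z) `^ c j)%:E <=
   (\prod_(j < m) heat (g j) 1 0 `^ c j)%:E)%E.
Proof.
move=> cg gb.
have mg j : measurable_fun setT (g j) by exact: continuous_measurable_fun.
pose e n : R := n.+1%:R^-1.
have e01 n : 0 < e n <= 1 by rewrite /e invr_gt0 ltr0n /= invf_le1 ?ler1n.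
pose t n := Num.sqrt (1 - e n ^+ 2).
have ce : e n @[n --> \oo] --> (0 : R) by exact: cvg_harmonic.
have ct : t n @[n --> \oo] --> (1 : R).
  have c1 : 1 - e n ^+ 2 @[n --> \oo] --> (1 - 0 ^+ 2 : R).
    apply: cvgB; first exact: cvg_cst.
    exact: (cvg_comp e (fun x => x ^+ 2) ce (@exprn_continuous _ 2 _)).
  have := cvg_comp _ _ c1 (@sqrt_continuous R _).
  by rewrite expr0n /= subr0 sqrtr1.
have hE j s x := EFin_heat (mg j) (ltW dl0) (gb j) s x.
have gn j x : `|g j x| <= B.
  by have /andP[h1 h2] := gb j x; rewrite ger0_norm // (le_trans (ltW dl0)).
have chn j x : heat (g j) (e n) (t n * x) @[n --> \oo] --> g j x.
  have : (\int[gauss]_y (g j (t n * x + e n * y))%:E @[n --> \oo] --> \int[gauss]_y (g j x)%:E)%E.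
    apply: (bounded_cvg_integral (B := B)) => // [n|y].
      exact: measurable_shift_scale.
    apply: (cvg_comp (fun n => t n * x + e n * y) (g j)); last exact: cg.
    have : t n * x + e n * y @[n --> \oo] --> (1 * x + 0 * y : R).
      by apply: cvgD; apply: cvgM => //; exact: cvg_cst.
    by rewrite mul1r mul0r addr0.
  rewrite integral_prob_cst => /fine_cvg /=.
  by apply: cvg_trans; apply: near_eq_cvg; apply: nearW => n; rewrite /= -hE.
pose PB := \prod_(j < m) B `^ c j.
have prodB (y : 'I_m -> R) : (forall j, dl <= y j <= B) ->
    `|\prod_(j < m) y j `^ c j| <= PB.
  move=> yb; rewrite ger0_norm; last by apply: prodr_ge0 => j _; exact: powR_ge0.
  apply: ler_prod => j _; rewrite powR_ge0 /=; have /andP[h1 h2] := yb j.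
  have y0 := le_trans (ltW dl0) h1.
  by rewrite ge0_ler_powR ?nnegrE // (le_trans y0).
have g0 j x : 0 < g j x by have /andP[+ _] := gb j x; exact: lt_le_trans.
have cflow : (flow A c g (e n) (t n) @[n --> \oo] -->
    \int[std_gaussian k]_z (\prod_(j < m) g j (dot (A j) z) `^ c j)%:E)%E.
  apply: (bounded_cvg_integral (B := PB)).
  - move=> n.
    rewrite (_ : (fun z => _) = fun z : k.-tuple R =>
       \prod_(j < m) heat (g j) (e n) ((fun=> 0) j + t n * dot (A j) z) `^ c j).
      exact: (measurable_flow_integrand _ c dl0 mg gb).
    by apply/funext => z; apply: eq_bigr => j _; rewrite add0r.
  - apply: measurable_prod => j _; apply: (measurableT_comp (measurable_powR _)).
    by apply: measurableT_comp => //; exact: measurable_dot.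
  - by move=> n z; apply: prodB => j; exact: heat_bounds (ltW dl0) (gb j) _ _.
  - by move=> z; apply: cvg_prodR => j; apply: cvg_powR.
rewrite -(cvg_lim _ cflow) //; apply: lime_le; first exact: cvgP cflow.
apply: nearW => n.
exact: (flow_le A1 c0 Adom dl0 dlB mg gb (e01 n)).
Qed.

End gaussian_bl.
End continuous_case.

(** * Approximation in Gaussian L^1 by continuous functions with the same bounds *)

Section L1_approximation.
Context {R : realType}.
Local Notation gauss := (@gauss R).
Local Notation mu := (@lebesgue_measure R).

(** Makes the Gaussian L^1 distance at most the Lebesgue one, for which continuous approximation on
    bounded sets is available. *)
Lemma gauss_density_le1 (x : R) : gauss_density x <= 1.
Proof.
have q1 : 1 <= pi *+ 2 :> R by have := pi_ge2 R; rewrite mulr2n; lra.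
have s1 : 1 <= Num.sqrt (pi *+ 2 : R).
  by rewrite -[leLHS]sqrtr1 ler_sqrt // (le_trans ler01).
have s0 : 0 < Num.sqrt (pi *+ 2 : R) by exact: lt_le_trans s1.
rewrite gauss_densityE -[leRHS]mulr1 ler_pM ?expR_ge0 ?invr_ge0 ?(ltW s0) //.
  by rewrite invf_le1.
by rewrite -[leRHS]expR0 ler_expR mulNr oppr_le0 divr_ge0 // sqr_ge0.
Qed.

Definition clip (b B x : R) : R := Num.min (Num.max x b) B.

Lemma continuous_clip b B (h : R -> R) : continuous h -> continuous (fun x => clip b B (h x)).
Proof.
move=> ch x.
apply: (@continuous_min R _ (fun x => Num.max (h x) b : R^o) (cst B)); last exact: cvg_cst.
by apply: (@continuous_max R _ h (cst b)); [exact: ch|exact: cvg_cst].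
Qed.

Lemma clip_bounds b B x : b <= B -> b <= clip b B x <= B.
Proof. by move=> bB; rewrite /clip le_min le_max lexx orbT bB ge_min lexx orbT. Qed.

(** Projection onto an interval moves no point away from a point [u] of that interval, so the bounds
    are restored without enlarging the approximation error. *)
Lemma ler_norm_clip b B u x : b <= u <= B -> `|u - clip b B x| <= `|u - x|.
Proof.
move=> /andP[bu uB]; rewrite /clip.
have [xb|xb] := leP x b.
  have -> : Num.min b B = b by apply/min_idPl/(le_trans bu).
  by rewrite !ger0_norm; lra.
have [xB|xB] := leP x B; first by [].
by rewrite !ler0_norm; lra.
Qed.

Lemma gauss_L1_approx (g : R -> R) b B e : 0 <= b -> measurable_fun setT g ->
  (forall x, b <= g x <= B) -> 0 < e ->
  exists h : R -> R, [/\ continuous h, forall x, b <= h x <= B &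
    (\int[gauss]_x `|g x - h x|%:E <= e%:E)%E].
Proof.
move=> b0 mg gb e0.
have bB : b <= B by have /andP[h1 h2] := gb 0; exact: le_trans h2.
have B0 : 0 <= B by exact: le_trans bB.
pose M : R := 2 * expR (9 / 2).
have M0 : 0 <= M by rewrite mulr_ge0 ?expR_ge0.
have BM0 : 0 <= 2 * (B * M) / e by rewrite divr_ge0 ?(ltW e0) // mulr_ge0 // mulr_ge0.
(* Outside [[-n, n]] one has [expw x >= n], so the difference, at most [B], is below
   [B / n * expw x]; this [n] makes the integral of that tail bound at most [e / 2]. *)
pose n := Num.bound (2 * (B * M) / e).
have nP : 2 * (B * M) / e < n%:R by exact: archi_boundP.
have n0 : 0 < n%:R :> R by exact: le_lt_trans nP.
have BMn : B / n%:R * M <= e / 2.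
  rewrite mulrAC ler_pdivrMr //; move: nP; rewrite ltr_pdivrMr // => nP; lra.
pose E : set R := `[- n%:R, n%:R]%classic.
have mE : measurable E by exact: measurable_itv.
have muE : mu E = (n%:R + n%:R)%:E.
  have nn : - n%:R < n%:R :> R by lra.
  by rewrite lebesgue_measure_itv /= lte_fin nn -EFinD opprK.
have muEoo : (mu E < +oo)%E by rewrite muE ltry.
have gB x : `|g x| <= B.
  by have /andP[h1 h2] := gb x; rewrite ger0_norm // (le_trans b0).
have ig : mu.-integrable E (EFin \o g).
  apply: measurable_bounded_integrable => //.
    exact: measurable_funTS.
  exists B; split; first exact: num_real.
  by move=> y By x _; apply: (le_trans (gB x)); exact: ltW.
have [g_ [cg_ ig_ lim_g]] := approximation_continuous_integrable mE muEoo ig.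
have [N HN] : exists N, (\int[mu]_(z in E) `|(g z - g_ N z)%:E| <= (e / 2)%:E)%E.
  have e20 : 0 < e / 2 by rewrite divr_gt0.
  have /fine_cvgP[fin_ /cvgrPdist_le /(_ _ e20)[N _ HN]] := lim_g.
  have [N' _ HN'] := fin_; exists (maxn N N').
  have := HN _ (leq_maxl N N') => /=.
  rewrite sub0r normrN => le.
  rewrite -[leLHS]fineK; last by apply: HN' => /=; exact: leq_maxr.
  by rewrite lee_fin (le_trans (ler_norm _)).
have mgN : measurable_fun setT (g_ N) by exact: continuous_measurable_fun.
exists (fun x => clip b B (g_ N x)); split.
- exact: continuous_clip.
- by move=> x; exact: clip_bounds.
have mclip : measurable_fun setT (fun x => clip b B (g_ N x)).
  by apply: continuous_measurable_fun; exact: continuous_clip.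
pose f1 x : R := `|g x - g_ N x| * \1_E x.
have mf1 : measurable_fun setT f1.
  apply: measurable_funM; last exact: measurable_indic.
  by apply: measurableT_comp => //; exact: measurable_funB.
have f10 x : 0 <= f1 x by rewrite mulr_ge0.
have mew : measurable_fun setT (fun x : R => B / n%:R * expw x).
  by apply: measurable_funM => //; exact: measurable_expw.
have Bn0 : 0 <= B / n%:R by rewrite divr_ge0.
have ew0 (x : R) : 0 <= B / n%:R * expw x by rewrite mulr_ge0 ?expw_ge0.
apply: (@le_trans _ _ (\int[gauss]_x (f1 x + B / n%:R * expw x)%:E)%E).
  apply: ge0_le_integral_fct => //.
  - by apply: measurableT_comp => //; exact: measurable_funB.
  - exact: measurable_funD.
  move=> x; rewrite /f1 indicE; have [xE|xE] := boolP (x \in E).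
    by rewrite mulr1 (le_trans (ler_norm_clip _ (gb x))) // lerDl.
  rewrite mulr0 add0r (@le_trans _ _ B) //.
    have /andP[h1 h2] := gb x; have /andP[h3 h4] := clip_bounds (g_ N x) bB.
    exact: (ler_norm_sub_bounds b0).
  rewrite -mulrA ler_peMr // ler_pdivlMl // mulr1.
  have nx : n%:R <= `|x|.
    rewrite leNgt; apply: contra xE => xn; rewrite inE /E /= in_itv /=.
    by rewrite -ler_norml ltW.
  by rewrite (le_trans nx) // (le_trans _ (expw_ge_norm x)) // lerDr.
rewrite ge0_integral_fctD //.
rewrite (_ : e = e / 2 + e / 2) ?EFinD; last by field.
apply: leeD; last first.
  rewrite (@ge0_integral_fctZ _ _ _ gauss _ (@expw R)) //.
  - by rewrite integral_expw -EFinM lee_fin.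
  - exact: measurable_expw.
  - by move=> x; exact: expw_ge0.
apply: le_trans HN; rewrite ge0_integral_gauss.
- rewrite [leRHS]integral_mkcond; apply: ge0_le_integral => //.
  + by move=> x _; rewrite -EFinM lee_fin mulr_ge0 ?gauss_density_ge0.
  + by apply: emeasurable_funM; apply/measurable_EFinP => //; exact: measurable_gauss_density.
  + apply/(measurable_restrictT _ mE); apply: measurable_funTS.
    apply/measurableT_comp => //; apply/measurable_EFinP; exact: measurable_funB.
  + move=> x _; rewrite -EFinM /f1 patchE indicE; case: ifPn => xE.
      by rewrite mulr1 /= lee_fin ler_piMr // gauss_density_le1.
    by rewrite mulr0 mul0r.
- exact/measurable_EFinP.
- by move=> x; rewrite lee_fin.
Qed.

End L1_approximation.

(** * Extension to measurable functions *)

Section gaussian_brascamp_lieb.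
Context {R : realType}.
Local Notation gauss := (@gauss R).
Variables (m k : nat) (A : 'I_m -> 'I_k -> R) (c : 'I_m -> R) (dl B : R).
Hypotheses (A1 : forall j, \sum_(l < k) A j l ^+ 2 = 1) (c0 : forall j, 0 <= c j)
  (Adom : forall D : 'I_m -> R, \sum_(l < k) (\sum_(j < m) c j * D j * A j l) ^+ 2 <=
     \sum_(j < m) c j * D j ^+ 2) (dl0 : 0 < dl) (dlB : dl <= B).

(** The two products differ by the factor [expR] of a weighted sum of log-quotients, itself at most
    [t = sum_j c_j |x_j - y_j| / dl]. As [t] stays below [t0], the exponential is controlled
    linearly. *)
Lemma prod_powR_lipschitz : exists2 L : R, 0 <= L &
  forall x y : 'I_m -> R, (forall j, dl <= x j <= B) -> (forall j, dl <= y j <= B) ->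
  \prod_(j < m) x j `^ c j <= \prod_(j < m) y j `^ c j + L * \sum_(j < m) `|x j - y j|.
Proof.
have B0 : 0 < B by exact: lt_le_trans dlB.
pose S := \sum_(j < m) c j; have S0 : 0 <= S by exact: sumr_ge0.
pose PB := \prod_(j < m) B `^ c j.
have PB0 : 0 <= PB by apply: prodr_ge0 => j _; exact: powR_ge0.
pose t0 := S * (B / dl).
exists (PB * expR t0 * (S / dl)).
  by apply: mulr_ge0; [rewrite mulr_ge0 ?expR_ge0|rewrite divr_ge0 ?(ltW dl0)].
move=> x y xb yb.
have x0 j : 0 < x j by have /andP[+ _] := xb j; exact: lt_le_trans.
have y0 j : 0 < y j by have /andP[+ _] := yb j; exact: lt_le_trans.
rewrite (prod_powR_quotient c x0 y0).
set P := \prod_(j < m) y j `^ c j.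
have P0 : 0 <= P by apply: prodr_ge0 => j _; exact: powR_ge0.
have PPB : P <= PB.
  apply: ler_prod => j _; rewrite powR_ge0 /=; have /andP[h1 h2] := yb j.
  by rewrite ge0_ler_powR ?nnegrE ?(ltW (y0 j)) ?(ltW B0).
pose t := \sum_(j < m) c j * (`|x j - y j| / dl).
have tt0 : t <= t0.
  rewrite /t /t0 /S mulr_suml ler_sum // => j _; rewrite ler_wpM2l //.
  rewrite ler_wpM2r ?invr_ge0 ?(ltW dl0) //.
  have /andP[h1 h2] := xb j; have /andP[h3 h4] := yb j.
  exact: ler_norm_sub_bounds (ltW dl0) h1 h2 h3 h4.
have t_ge0 : 0 <= t.
  by apply: sumr_ge0 => j _; rewrite mulr_ge0 // divr_ge0 ?(ltW dl0).
have Tt : \sum_(j < m) c j * ln (x j / y j) <= t.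
  apply: ler_sum => j _; rewrite ler_wpM2l //.
  have -> : x j / y j = 1 + (x j - y j) / y j by field; rewrite gt_eqF.
  have xy0 : 0 < x j / y j by exact: divr_gt0.
  rewrite (le_trans (le_ln1Dx _)) //.
    by rewrite mulrBl divff ?gt_eqF //; lra.
  rewrite (le_trans (ler_norm _)) // normrM (gtr0_norm (_ : 0 < (y j)^-1)) ?invr_gt0 //.
  rewrite ler_wpM2l // lef_pV2 ?posrE //.
  by have /andP[] := yb j.
(* From [1 - t <= expR (- t)] follows [expR t <= 1 + t expR t], and then [t <= t0] is used in the
   last exponential. *)
have et : expR (\sum_(j < m) c j * ln (x j / y j)) <= 1 + expR t0 * t.
  apply: (@le_trans _ _ (expR t)); first by rewrite ler_expR; exact: Tt.
  have h := expR_ge1Dx (- t).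
  have : expR t * (1 - t) <= 1.
    by rewrite -[leRHS](expRxMexpNx_1 t) ler_wpM2l ?expR_ge0.
  have : expR t * t <= expR t0 * t by rewrite ler_wpM2r ?ler_expR.
  lra.
rewrite (le_trans (ler_wpM2l P0 et)) // mulrDr mulr1 lerD2l.
have tS : t <= S / dl * \sum_(j < m) `|x j - y j|.
  rewrite /t mulr_sumr ler_sum // => j _; rewrite mulrA mulrAC ler_wpM2r //.
  rewrite ler_wpM2r ?invr_ge0 ?(ltW dl0) // /S (bigD1 j) //= lerDl.
  by apply: sumr_ge0.
have PBe0 : 0 <= PB * expR t0 by rewrite mulr_ge0 ?expR_ge0.
apply: (@le_trans _ _ (PB * expR t0 * t)).
  by rewrite -mulrA; apply: ler_wpM2r; rewrite ?mulr_ge0 ?expR_ge0.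
by rewrite -[leRHS]mulrA; exact: ler_wpM2l.
Qed.

Lemma gaussian_brascamp_lieb (g : 'I_m -> R -> R) :
  (forall j, measurable_fun setT (g j)) -> (forall j x, dl <= g j x <= B) ->
  (\int[std_gaussian k]_z (\prod_(j < m) g j (dot (A j) z) `^ c j)%:E <=
   (\prod_(j < m) heat (g j) 1 0 `^ c j)%:E)%E.
Proof.
move=> mg gb; have [L L0 HL] := prod_powR_lipschitz.
apply/lee_addgt0Pr => eta eta0.
(* The approximation error [L m e] is paid twice, for the integral of the product and for the means
   on the right; the [+ 1] keeps the denominator positive. *)
pose e := eta / (2 * L * m%:R + 1).
have d0 : 0 < 2 * L * m%:R + 1 by rewrite ltr_wpDl // !mulr_ge0.
have e0 : 0 < e by rewrite divr_gt0.
have /choice[h Hh] : forall j, exists h : R -> R, [/\ continuous h,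
    forall x, dl <= h x <= B & (\int[gauss]_x `|g j x - h x|%:E <= e%:E)%E].
  by move=> j; exact: gauss_L1_approx (ltW dl0) (mg j) (gb j) e0.
have ch j : continuous (h j) by have [] := Hh j.
have hb j x : dl <= h j x <= B by have [_ + _] := Hh j; exact.
have he j : (\int[gauss]_x `|g j x - h j x|%:E <= e%:E)%E by have [] := Hh j.
have mh j : measurable_fun setT (h j) by exact: continuous_measurable_fun.
have md j : measurable_fun setT (fun x => `|g j x - h j x|).
  by apply: measurableT_comp => //; exact: measurable_funB.
have mdot (f : 'I_m -> R -> R) : (forall j, measurable_fun setT (f j)) ->
    measurable_fun setT (fun z : k.-tuple R => \prod_(j < m) f j (dot (A j) z) `^ c j).
  move=> mf; apply: measurable_prod => j _.
  apply: (measurableT_comp (measurable_powR _)).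
  by apply: measurableT_comp => //; exact: measurable_dot.
have prod0 (y : 'I_m -> R) : 0 <= \prod_(j < m) y j `^ c j.
  by apply: prodr_ge0 => j _; exact: powR_ge0.
have mdd j : measurable_fun setT (fun z : k.-tuple R => `|g j (dot (A j) z) - h j (dot (A j) z)|).
  apply: (measurableT_comp (f := fun x => `|g j x - h j x|)) => //.
  exact: measurable_dot.
have mds : measurable_fun setT (fun z : k.-tuple R =>
    \sum_(j < m) `|g j (dot (A j) z) - h j (dot (A j) z)|).
  exact: measurable_sum.
have ds0 (z : k.-tuple R) : 0 <= \sum_(j < m) `|g j (dot (A j) z) - h j (dot (A j) z)|.
  by apply: sumr_ge0.
apply: (@le_trans _ _ (\int[std_gaussian k]_z (\prod_(j < m) h j (dot (A j) z) `^ c j +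
    L * \sum_(j < m) `|g j (dot (A j) z) - h j (dot (A j) z)|)%:E)%E).
  apply: ge0_le_integral_fct => //.
  - exact: mdot.
  - by apply: measurable_funD; [exact: mdot|exact: measurable_funM].
  - by move=> z; exact: (HL (fun j => g j (dot (A j) z)) (fun j => h j (dot (A j) z))).
rewrite ge0_integral_fctD //; last 3 first.
- exact: mdot.
- exact: measurable_funM.
- by move=> z; rewrite mulr_ge0.
have I2 : (\int[std_gaussian k]_z (L * \sum_(j < m) `|g j (dot (A j) z) - h j (dot (A j) z)|)%:E
    <= (L * (m%:R * e))%:E)%E.
  rewrite ge0_integral_fctZ // EFinM lee_wpmul2l ?lee_fin //.
  rewrite ge0_integral_fct_sum //.
  apply: (@le_trans _ _ (\sum_(j < m) e%:E)%E); last first.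
    by rewrite (sumEFin _ _ (fun=> e)) lee_fin sumr_const card_ord mulr_natl.
  apply: lee_sum => j _; apply: le_trans (he j).
  rewrite (std_gaussian_dot (s := 1) (f := fun x => `|g j x - h j x|%:E)).
  - by under eq_integral do rewrite mul1r.
  - by rewrite A1 expr1n.
  - exact/measurable_EFinP.
  - by move=> x; rewrite lee_fin.
apply: (le_trans (leeD (gaussian_bl_continuous A1 c0 Adom dl0 dlB ch hb) I2)).
rewrite -!EFinD lee_fin.
have hgb j : `|heat (h j) 1 0 - heat (g j) 1 0| <= e.
  have ih := integrable_heat (mh j) (ltW dl0) (hb j) 1 0.
  have ig := integrable_heat (mg j) (ltW dl0) (gb j) 1 0.
  rewrite /heat -RintegralB //.
  have idf := integrableB measurableT ih ig.
  rewrite -lee_fin EFin_normr_Rintegral //.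
  apply: (le_trans (le_abse_integral _ _ _)) => //.
    exact: measurable_int idf.
  apply: le_trans (he j); rewrite le_eqVlt; apply/orP; left; apply/eqP.
  by apply: eq_integral => x _; rewrite /= add0r mul1r distrC.
have bh (f : 'I_m -> R -> R) : (forall j, measurable_fun setT (f j)) ->
    (forall j x, dl <= f j x <= B) -> forall j, dl <= heat (f j) 1 0 <= B.
  by move=> mf fb j; exact: heat_bounds (mf j) (ltW dl0) (fb j) _ _.
have := HL _ _ (bh _ mh hb) (bh _ mg gb).
have : \sum_(j < m) `|heat (h j) 1 0 - heat (g j) 1 0| <= m%:R * e.
  apply: (@le_trans _ _ (\sum_(j < m) e)); first exact: ler_sum.
  by rewrite sumr_const card_ord mulr_natl.
move=> /(ler_wpM2l L0) h1 h2.
have : L * (m%:R * e) + L * (m%:R * e) <= eta.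
  rewrite (_ : _ + _ = eta * ((2 * L * m%:R) / (2 * L * m%:R + 1))); last first.
    by rewrite /e; field; rewrite gt_eqF.
  by rewrite ler_piMr ?(ltW eta0) // ler_pdivrMr // mul1r lerDl.
lra.
Qed.

End gaussian_brascamp_lieb.

(** * Hypercontractivity *)

Section transfer.
Context {R : realType} (m : nat) d (T : measurableType d) (P : probability T R).
Variables (X : 'I_m -> {RV P >-> R}) (k : nat) (A : 'M[R]_(m, k)).
Local Notation gauss := (@gauss R).
Hypothesis AX : forall B : set (m.-tuple R), measurable B ->
  P [set w | B [tuple X j w | j < m]] =
  std_gaussian k [set z | B [tuple \sum_(l < k) A j l * tnth z l | j < m]].
Hypothesis A1 : forall j, \sum_(l < k) A j l ^+ 2 = 1.

Lemma law_transfer (G : m.-tuple R -> \bar R) : measurable_fun setT G ->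
  (forall t, 0 <= G t)%E ->
  (\int[P]_w G [tuple X j w | j < m] =
   \int[std_gaussian k]_z G [tuple dot (A j) z | j < m])%E.
Proof.
move=> mG G0; pose Xt w := [tuple X j w | j < m].
pose At (z : k.-tuple R) := [tuple dot (A j) z | j < m].
have mX : measurable_fun setT Xt.
  apply/measurable_fun_tnthP => j; rewrite (_ : _ \o _ = X j) //.
  by apply/funext => w /=; rewrite tnth_mktuple.
have mA : measurable_fun setT At.
  apply/measurable_fun_tnthP => j; rewrite (_ : _ \o _ = dot (A j)).
    exact: measurable_dot.
  by apply/funext => z /=; rewrite tnth_mktuple.
transitivity (\int[pushforward P Xt]_t G t)%E.
  by rewrite ge0_integral_pushforward.
transitivity (\int[pushforward (std_gaussian k) At]_t G t)%E; last first.
  by rewrite ge0_integral_pushforward.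
by apply: eq_measure_integral => B mB _; exact: AX.
Qed.

Lemma law_transfer_prod (f : 'I_m -> R -> R) :
  (forall j, measurable_fun setT (f j)) -> (forall j x, 0 <= f j x) ->
  (\int[P]_w (\prod_(j < m) f j (X j w))%:E =
   \int[std_gaussian k]_z (\prod_(j < m) f j (dot (A j) z))%:E)%E.
Proof.
move=> mf f0; pose G (t : m.-tuple R) := (\prod_(j < m) f j (tnth t j))%:E.
transitivity (\int[P]_w G [tuple X j w | j < m])%E.
  apply: eq_integral => w _; congr EFin.
  by apply: eq_bigr => j _; rewrite tnth_mktuple.
rewrite law_transfer.
- apply: eq_integral => z _; congr EFin.
  by apply: eq_bigr => j _; rewrite tnth_mktuple.
- apply/measurable_EFinP; apply: measurable_prod => j _.
  by apply: measurableT_comp => //; exact: measurable_tnth.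
- by move=> t; rewrite lee_fin prodr_ge0.
Qed.

Lemma law_transfer1 (j : 'I_m) (f : R -> R) :
  measurable_fun setT f -> (forall x, 0 <= f x) ->
  (\int[P]_w (f (X j w))%:E = \int[gauss]_x (f x)%:E)%E.
Proof.
move=> mf f0; pose G (t : m.-tuple R) := (f (tnth t j))%:E.
transitivity (\int[P]_w G [tuple X j w | j < m])%E.
  by apply: eq_integral => w _; rewrite /G tnth_mktuple.
rewrite law_transfer.
- transitivity (\int[std_gaussian k]_z (f (dot (A j) z))%:E)%E.
    by apply: eq_integral => z _; rewrite /G tnth_mktuple.
  rewrite (std_gaussian_dot (s := 1) (f := fun x => (f x)%:E)).
  + by under eq_integral do rewrite mul1r.
  + by rewrite A1 expr1n.
  + exact/measurable_EFinP.
  + by move=> x; rewrite lee_fin.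
- apply/measurable_EFinP; apply: measurableT_comp => //; exact: measurable_tnth.
- by move=> t; rewrite lee_fin.
Qed.

End transfer.

Lemma quadratic_form (R : realType) m k (A : 'M[R]_(m, k)) (v : 'cV[R]_m) :
  (v^T *m (A *m A^T) *m v) 0 0 = \sum_(l < k) (\sum_(j < m) v j 0 * A j l) ^+ 2.
Proof.
have -> : v^T *m (A *m A^T) *m v = (v^T *m A) *m (v^T *m A)^T.
  by rewrite trmx_mul trmxK !mulmxA.
rewrite mxE; apply: eq_bigr => l _; rewrite [X in _ * X]mxE -expr2 mxE.
by congr (_ ^+ 2); apply: eq_bigr => j _; rewrite mxE.
Qed.

Section lnorm.
Context {R : realType} d (T : measurableType d) (P : probability T R).

Lemma Lnorm_EFin_powR (f : T -> R) (r J : R) :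
  (\int[P]_w (`|f w| `^ r)%:E = J%:E)%E ->
  ('N[P]_(r%:E)[EFin \o f] = (J `^ r^-1)%:E)%E.
Proof.
move=> HJ; rewrite unlock /=.
under eq_integral do rewrite -/(abse _%:E) /=.
by rewrite HJ poweR_EFin.
Qed.

Lemma Lnorm_fin_num (f : T -> R) (p : \bar R) B : measurable_fun setT f ->
  (1 <= p)%E -> (forall x, `|f x| <= B) -> ('N[P]_p[EFin \o f])%E \is a fin_num.
Proof.
move=> mf p1 fB; rewrite ge0_fin_numE ?Lnorm_ge0 //.
move: p p1 => [r||] // p1; rewrite unlock /=.
  apply: poweR_lty.
  apply: (@le_lt_trans _ _ (\int[P]__ (`|B| `^ r)%:E)%E); last first.
    by rewrite integral_prob_cst ltry.
  apply: ge0_le_integral => //.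
  - apply/measurable_EFinP; apply: (measurableT_comp (measurable_powR _)).
    exact: measurableT_comp.
  - move=> x _; rewrite lee_fin ge0_ler_powR ?nnegrE //.
      by move: p1; rewrite lee_fin; exact: le_trans.
    by rewrite (le_trans (fB x)) // ler_norm.
rewrite probability_setT lte01.
apply: (@le_lt_trans _ _ B%:E); last exact: ltry.
by apply/ess_supP; apply: aeW => x /=; rewrite lee_fin.
Qed.

End lnorm.

Section characterization.
Context {R : realType} (m : nat) d (T : measurableType d) (P : probability T R).
Variables (X : 'I_m -> {RV P >-> R}) (k : nat) (A : 'M[R]_(m, k)) (p : 'I_m -> \bar R).
Local Notation gauss := (@gauss R).
Hypothesis AX : forall B : set (m.-tuple R), measurable B ->
  P [set w | B [tuple X j w | j < m]] =
  std_gaussian k [set z | B [tuple \sum_(l < k) A j l * tnth z l | j < m]].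
Hypothesis A1 : forall j, \sum_(l < k) A j l ^+ 2 = 1.
Hypothesis p1 : forall j, (1 <= p j)%E.

(* [r j] = 0 when [p j] = +oo, hence also [(r j)^-1] = 0 there. *)
Let r j := fine (p j).

Let r0 j : 0 <= r j.
Proof. by rewrite fine_ge0 // (le_trans _ (p1 j)). Qed.

Lemma exponentE j : p j = (r j)%:E /\ 1 <= r j \/ p j = +oo%E /\ r j = 0.
Proof.
rewrite /r; have := p1 j; case: (p j) => [s||] //=; last by right.
by rewrite lee_fin; left.
Qed.

(** The test vector [v_j = D_j / r_j] turns [p_j v_j^2] into [D_j^2 / r_j]. Where [p j = +oo] the
    convention [(r j)^-1 = 0] forces [v_j = 0], and both sides contribute zero. *)
Lemma diag_dominates_contraction : diag_dominates p (A *m A^T) ->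
  forall D : 'I_m -> R, \sum_(l < k) (\sum_(j < m) (r j)^-1 * D j * A j l) ^+ 2 <=
    \sum_(j < m) (r j)^-1 * D j ^+ 2.
Proof.
move=> dom D; have := dom (\col_j ((r j)^-1 * D j)).
rewrite quadratic_form.
under eq_bigr do under eq_bigr do rewrite mxE.
rewrite (_ : (\sum_(j < m) _)%E = (\sum_(j < m) (r j)^-1 * D j ^+ 2)%:E).
  by rewrite lee_fin.
rewrite -sumEFin; apply: eq_bigr => j _; rewrite mxE.
have [[-> rj]|[-> ->]] := exponentE j.
  have rn0 : r j != 0 by rewrite gt_eqF // (lt_le_trans ltr01).
  by rewrite -EFinM; congr EFin; field.
by rewrite invr0 !mul0r expr0n /= mule0.
Qed.

(** * From the matrix inequality to hypercontractivity *)

Section sufficiency.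
Variable f : 'I_m -> R -> R.
Hypothesis mf : forall j, measurable_fun [set: R] (f j).
Hypothesis bf : forall j, bounded_fun (f j : R -> R^o).
Hypothesis dom : diag_dominates p (A *m A^T).

Let N j := fine ('N[P]_(p j)[EFin \o (f j \o X j)])%E.

Lemma uniform_bound : exists2 B : R, 0 <= B & forall j x, `|f j x| <= B.
Proof.
have /choice[M HM] : forall j, exists M : R, forall x, `|f j x| <= M.
  move=> j; have [M0 [_ HM0]] := bf j; exists (M0 + 1) => x.
  by apply: HM0 => //; rewrite ltrDl.
exists (\sum_(j < m) `|M j|); first exact: sumr_ge0.
move=> j x; rewrite (le_trans (HM j x)) // (le_trans (ler_norm _)) //.
by rewrite (bigD1 j) //= lerDl sumr_ge0.
Qed.

Let mfX j : measurable_fun setT (f j \o X j).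
Proof. exact: measurableT_comp. Qed.

Lemma Lnorm_finE j : ('N[P]_(p j)[EFin \o (f j \o X j)] = (N j)%:E)%E.
Proof.
have [B _ fB] := uniform_bound; rewrite /N fineK //.
by apply: (@Lnorm_fin_num _ _ _ _ _ _ B) => // x; exact: fB.
Qed.

(** The shift by [dl] keeps the [g j] away from zero, as the Brascamp-Lieb inequality requires;
    Minkowski's inequality shows that it raises each finite-exponent norm by at most [dl]. *)
Lemma expectation_le_shifted (dl : R) : 0 < dl <= 1 ->
  ('E_P[(fun w => \prod_(j < m) f j (X j w))%R] <= (\prod_(j < m) (N j + dl))%:E)%E.
Proof.
move=> /andP[dl0 dl1]; have [B B0 fB] := uniform_bound.
pose g j x := (`|f j x| + dl) `^ r j.
(* One exponent above all [r j]: since [dl <= 1 <= B + 1], it yields lower and upper bounds common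
   to all [g j]. *)
pose Rm := \sum_(j < m) r j.
have rR j : r j <= Rm by rewrite /Rm (bigD1 j) //= lerDl sumr_ge0.
have B1 : 1 <= B + 1 by rewrite lerDr.
have gb j x : dl `^ Rm <= g j x <= (B + 1) `^ Rm.
  have f0 := normr_ge0 (f j x); apply/andP; split.
    apply: (@le_trans _ _ (dl `^ r j)); first by rewrite ger_powR ?dl0.
    by rewrite ge0_ler_powR ?nnegrE ?addr_ge0 ?(ltW dl0) // lerDr.
  apply: (@le_trans _ _ ((B + 1) `^ r j)); last by rewrite ler_powR.
  by rewrite ge0_ler_powR ?nnegrE ?addr_ge0 ?(ltW dl0) // lerD.
have mg j : measurable_fun setT (g j).
  apply: (measurableT_comp (measurable_powR _)).
  by apply: measurable_funD => //; exact: measurableT_comp.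
have dlR0 : 0 < dl `^ Rm by exact: powR_gt0.
have dlB : dl `^ Rm <= (B + 1) `^ Rm.
  rewrite ge0_ler_powR ?nnegrE ?(ltW dl0) ?sumr_ge0 //.
    by rewrite (le_trans ler01).
  by rewrite (le_trans dl1).
have c0 j : 0 <= (r j)^-1 by rewrite invr_ge0.
(* For an infinite exponent [g j] is constantly 1, a power with exponent 0, and [n j] carries the
   essential supremum; for a finite one the roles are reversed and [n j = 1]. *)
pose n j := if p j == +oo%E then N j else 1.
have N0 j : 0 <= N j by rewrite /N fine_ge0 // Lnorm_ge0.
have n0 j : 0 <= n j by rewrite /n; case: ifP.
have PT : (0 < P [set: T])%E by rewrite probability_setT.
have fn : \forall w \ae P, forall j, `|f j (X j w)| <= n j * g j (X j w) `^ (r j)^-1.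
  apply: filter_forall => j; rewrite /n /g; have [[pj rj]|[pj rj]] := exponentE j.
    apply: aeW => w; rewrite pj /= mul1r -powRrM mulfV ?gt_eqF ?(lt_le_trans ltr01) //.
    by rewrite powRr1 ?addr_ge0 ?(ltW dl0) // lerDl ltW.
  rewrite pj eqxx rj invr0; have := Lnorm_finE j; rewrite pj unlock PT => ess.
  apply: filterS (ess_sup_ge P (abse \o (EFin \o (f j \o X j)))) => w.
  by rewrite ess /= lee_fin powRr0 mulr1.
have prod0 w : 0 <= \prod_(j < m) g j (X j w) `^ (r j)^-1.
  by apply: prodr_ge0 => j _; exact: powR_ge0.
have PN0 : 0 <= \prod_(j < m) n j by exact: prodr_ge0.
have mprod : measurable_fun setT (fun w => \prod_(j < m) f j (X j w)).
  by apply: measurable_prod => j _; exact: mfX.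
have mprodg : measurable_fun setT (fun w => \prod_(j < m) g j (X j w) `^ (r j)^-1).
  apply: measurable_prod => j _; apply: (measurableT_comp (measurable_powR _)).
  exact: measurableT_comp.
have step1 : ('E_P[(fun w => \prod_(j < m) f j (X j w))%R] <=
  \int[P]_w ((\prod_(j < m) n j) * \prod_(j < m) g j (X j w) `^ (r j)^-1)%:E)%E.
  rewrite unlock; apply: (le_trans (lee_abs _)).
  have me : measurable_fun setT (fun w => (\prod_(j < m) f j (X j w))%:E).
    exact/measurable_EFinP.
  apply: (le_trans (le_abse_integral P measurableT me)).
  apply: ae_ge0_le_integral => //.
  - exact: measurableT_comp.
  - by move=> w _; rewrite lee_fin mulr_ge0.
  - by apply/measurable_EFinP; exact: measurable_funM.
  apply: filterS fn => w fw _ /=; rewrite lee_fin -big_split /= normr_prod.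
  by apply: ler_prod => j _; rewrite normr_ge0 /=.
apply: (le_trans step1); rewrite ge0_integral_fctZ //.
rewrite (law_transfer_prod AX (f := fun j x => g j x `^ (r j)^-1)); last 2 first.
- by move=> j; exact: (measurableT_comp (measurable_powR _)).
- by move=> j x; exact: powR_ge0.
have PN0E : (0 <= (\prod_(j < m) n j)%:E)%E by rewrite lee_fin.
apply: (le_trans (lee_wpmul2l PN0E (gaussian_brascamp_lieb A1 c0
  (diag_dominates_contraction dom) dlR0 dlB mg gb))).
rewrite -EFinM lee_fin -big_split /=; apply: ler_prod => j _.
rewrite mulr_ge0 ?powR_ge0 //= /n; have [[pj rj]|[pj rj]] := exponentE j; last first.
  by rewrite pj eqxx rj invr0 powRr0 mulr1 lerDl ltW.
rewrite [in X in X == _]pj /= mul1r.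
have rn0 : r j != 0 by rewrite gt_eqF // (lt_le_trans ltr01).
have mabs : measurable_fun setT (fun w => `|f j (X j w)|) by exact: measurableT_comp (mfX j).
have N1 : ('N[P]_(r j)%:E[EFin \o ((fun w => `|f j (X j w)|) \+ cst dl)%R] =
    (heat (g j) 1 0 `^ (r j)^-1)%:E)%E.
  apply: Lnorm_EFin_powR; rewrite (EFin_heat (mg j) (ltW dlR0) (gb j)).
  under eq_integral do rewrite ger0_norm ?addr_ge0 ?(ltW dl0) //.
  rewrite [LHS](law_transfer1 AX A1 j (mg j) (fun x => powR_ge0 _ _)).
  by apply: eq_integral => x _; rewrite add0r mul1r.
have N2 : ('N[P]_(r j)%:E[EFin \o (cst dl : T -> R)] = dl%:E)%E.
  rewrite (@Lnorm_EFin_powR _ _ _ _ _ _ (dl `^ r j)).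
    by rewrite -powRrM mulfV // powRr1 // ltW.
  rewrite -[RHS](integral_prob_cst P); apply: eq_integral => w _ /=.
  by rewrite gtr0_norm.
have N3 : ('N[P]_(r j)%:E[EFin \o (fun w => `|f j (X j w)|)%R] = (N j)%:E)%E.
  rewrite -Lnorm_finE pj -[RHS]Lnorm_abse; apply: eq_Lnorm => w.
  by [].
(* Minkowski's inequality for [|f j|] and the constant [dl]. *)
rewrite -lee_fin -N1 EFinD -N3 -N2; apply: minkowski_EFin => //.
Qed.

Lemma expectation_le_prod_Lnorm :
  ('E_P[(fun w => \prod_(j < m) f j (X j w))%R] <=
   \prod_(j < m) 'N[P]_(p j)[EFin \o (f j \o X j)])%E.
Proof.
under eq_bigr do rewrite Lnorm_finE.
rewrite prodEFin.
have lim : (\prod_(j < m) (N j + n.+1%:R^-1))%:E @[n --> \oo] --> (\prod_(j < m) N j)%:E.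
  apply: cvg_EFin; first exact: nearW.
  apply: cvg_prodR => j; rewrite -[X in _ --> X]addr0.
  by apply: cvgD; [exact: cvg_cst|exact: cvg_harmonic].
rewrite -(cvg_lim _ lim) //; apply: lime_ge; first exact: cvgP lim.
apply: nearW => n; apply: expectation_le_shifted.
by rewrite invr_gt0 ltr0n /= invf_le1 ?ler1n.
Qed.

End sufficiency.

(** * From hypercontractivity to the matrix inequality *)

Section necessity.
Hypothesis hyp : hypercontractive X p.
Variable v : 'cV[R]_m.
Hypothesis v0 : forall j, p j = +oo%E -> v j 0 = 0.

Let Q := \sum_(l < k) (\sum_(j < m) v j 0 * A j l) ^+ 2.

Definition trunc_exp (n : nat) (j : 'I_m) (x : R) : R := Num.min (expR (v j 0 * x)) n%:R.

Lemma trunc_exp_ge0 n j x : 0 <= trunc_exp n j x.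
Proof. by rewrite /trunc_exp le_min expR_ge0 ler0n. Qed.

Lemma trunc_exp_le n j x : trunc_exp n j x <= expR (v j 0 * x).
Proof. by rewrite /trunc_exp ge_min lexx. Qed.

Lemma measurable_trunc_exp n j : measurable_fun [set: R] (trunc_exp n j).
Proof.
by apply: measurable_minr => //; apply: measurableT_comp => //.
Qed.

(** Without truncation and for finite [r], the norm is the [r]-th root of a Gaussian moment
    generating function at [r v_j], and truncation only lowers it. For [p j = +oo], [v_j = 0] makes
    the function at most 1, which matches [expR 0]. *)
Lemma Lnorm_trunc_exp n j :
  ('N[P]_(p j)[EFin \o (trunc_exp n j \o X j)] <= (expR (r j * v j 0 ^+ 2 / 2))%:E)%E.
Proof.
have mt := measurable_trunc_exp n j.
have PT : (0 < P [set: T])%E by rewrite probability_setT.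
have [[pj rj]|[pj rj]] := exponentE j; last first.
  rewrite pj rj mul0r mul0r expR0 unlock PT; apply/ess_supP/aeW => w /=.
  rewrite lee_fin ger0_norm ?trunc_exp_ge0 // (le_trans (trunc_exp_le _ _ _)) //.
  by rewrite v0 // mul0r expR0.
have rn0 : r j != 0 by rewrite gt_eqF // (lt_le_trans ltr01).
have mp : measurable_fun [set: R] (fun x => trunc_exp n j x `^ r j).
  exact: (measurableT_comp (measurable_powR _)).
rewrite pj unlock /=.
have -> : (\int[P]_w (`|trunc_exp n j (X j w)| `^ r j)%:E =
    \int[gauss]_x (trunc_exp n j x `^ r j)%:E)%E.
  rewrite -[RHS](law_transfer1 AX A1 j mp (fun x => powR_ge0 _ _)).
  by apply: eq_integral => w _; rewrite ger0_norm ?trunc_exp_ge0.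
apply: (@le_trans _ _ (((expR ((r j * v j 0) ^+ 2 / 2))%:E) `^ (r j)^-1)%E).
  have inR (y : \bar R) : (0 <= y)%E -> y \in `[0%E, +oo%E].
    by move=> y0; rewrite in_itv /= y0 leey.
  apply: gt0_ler_poweR.
  - by rewrite invr_ge0.
  - by apply: inR; apply: integral_ge0 => x _; rewrite lee_fin powR_ge0.
  - by apply: inR; rewrite lee_fin expR_ge0.
  rewrite -gauss_mgf; apply: ge0_le_integral_fct => //.
  - exact: measurableT_comp.
  - by move=> x; exact: powR_ge0.
  - move=> x; rewrite -mulrA mulrC expRM.
    by rewrite ge0_ler_powR ?nnegrE ?trunc_exp_ge0 ?expR_ge0 ?trunc_exp_le.
rewrite poweR_EFin lee_fin -expRM ler_expR le_eqVlt; apply/orP; left; apply/eqP.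
by field.
Qed.

Lemma mgf_le : expR (Q / 2) <= expR ((\sum_(j < m) r j * v j 0 ^+ 2) / 2).
Proof.
pose bb l := \sum_(j < m) v j 0 * A j l.
have bbE z : dot bb z = \sum_(j < m) v j 0 * dot (A j) z.
  rewrite /dot /bb; under eq_bigr do rewrite mulr_suml.
  rewrite exchange_big; apply: eq_bigr => j _ /=.
  by rewrite mulr_sumr; apply: eq_bigr => l _; rewrite mulrA.
have Q0 : 0 <= Q by apply: sumr_ge0 => l _; exact: sqr_ge0.
have IQ : (\int[std_gaussian k]_z (\prod_(j < m) expR (v j 0 * dot (A j) z))%:E =
    (expR (Q / 2))%:E)%E.
  (* [bb] is the vector [A^T v] of squared norm [Q], so its linear form is [Num.sqrt Q] times a
     standard Gaussian variable. *)
  rewrite -(sqr_sqrtr Q0) -gauss_mgf.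
  rewrite -(std_gaussian_dot (a := bb) (f := fun x => (expR x)%:E)).
  - by apply: eq_integral => z _; rewrite bbE expR_sum.
  - by rewrite sqr_sqrtr.
  - exact/measurable_EFinP.
  - by move=> x; rewrite lee_fin expR_ge0.
have mprod n : measurable_fun setT (fun z : k.-tuple R =>
    \prod_(j < m) trunc_exp n j (dot (A j) z)).
  apply: measurable_prod => j _; apply: measurableT_comp; last exact: measurable_dot.
  exact: measurable_trunc_exp.
have main n : (\int[std_gaussian k]_z (\prod_(j < m) trunc_exp n j (dot (A j) z))%:E <=
   (expR ((\sum_(j < m) r j * v j 0 ^+ 2) / 2))%:E)%E.
  rewrite -(law_transfer_prod AX (@measurable_trunc_exp n) (@trunc_exp_ge0 n)).
  have bt j : bounded_fun (trunc_exp n j : R -> R^o).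
    exists n%:R; split; first exact: num_real.
    move=> y ny x _; rewrite /= ger0_norm ?trunc_exp_ge0 //.
    by rewrite (le_trans _ (ltW ny)) // /trunc_exp ge_min lexx orbT.
  have -> : (\int[P]_w (\prod_(j < m) trunc_exp n j (X j w))%:E =
      'E_P[(fun w => \prod_(j < m) trunc_exp n j (X j w))%R])%E.
    by rewrite [in RHS]unlock.
  apply: (le_trans (hyp (@measurable_trunc_exp n) bt)).
  have fin j : ('N[P]_(p j)[EFin \o (trunc_exp n j \o X j)])%E \is a fin_num.
    apply: (@Lnorm_fin_num _ _ _ _ _ _ n%:R) => //.
      exact: measurableT_comp (measurable_trunc_exp n j) _.
    by move=> x /=; rewrite ger0_norm ?trunc_exp_ge0 // /trunc_exp ge_min lexx orbT.
  under eq_bigr do rewrite -(fineK (fin _)).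
  rewrite prodEFin lee_fin mulr_suml expR_sum; apply: ler_prod => j _.
  by rewrite fine_ge0 ?Lnorm_ge0 //= -lee_fin fineK // Lnorm_trunc_exp.
have trunc_nd j x : {homo (fun n => trunc_exp n j x) : a b / (a <= b)%N >-> a <= b}.
  by move=> a b ab; rewrite /trunc_exp le_min2 // ler_nat.
rewrite -lee_fin -IQ.
have lim : (\int[std_gaussian k]_z (\prod_(j < m) trunc_exp n j (dot (A j) z))%:E)%E
    @[n --> \oo] -->
    (\int[std_gaussian k]_z (\prod_(j < m) expR (v j 0 * dot (A j) z))%:E)%E.
  rewrite (_ : (\int[_]_z (\prod_(j < m) expR _)%:E)%E = (\int[std_gaussian k]_z
      lim ((\prod_(j < m) trunc_exp n j (dot (A j) z))%:E @[n --> \oo]))%E).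
    apply: cvg_monotone_convergence => //.
    - by move=> n; exact/measurable_EFinP.
    - by move=> n z _; rewrite lee_fin prodr_ge0 // => j _; exact: trunc_exp_ge0.
    - move=> z _ a b ab; rewrite lee_fin; apply: ler_prod => j _.
      by rewrite trunc_exp_ge0 trunc_nd.
  apply: eq_integral => z _; apply/esym/cvg_lim => //.
  apply: cvg_EFin; first exact: nearW.
  (* At a fixed point the truncation is inactive once [n] exceeds the exponential, so each factor is
     eventually constant. *)
  apply: cvg_prodR => j; apply: cvg_near_cst.
  near=> n; rewrite /trunc_exp min_l //.
  near: n; exact: nbhs_infty_ger.
rewrite -(cvg_lim _ lim) //; apply: lime_le; first exact: cvgP lim.
by apply: nearW => n; exact: main.
Unshelve. all: by end_near. Qed.

End necessity.

Lemma hypercontractive_diag_dominates :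
  hypercontractive X p -> diag_dominates p (A *m A^T).
Proof.
move=> hyp v; rewrite quadratic_form.
have pv0 j : (0 <= p j * (v j 0 ^+ 2)%:E)%E.
  by rewrite mule_ge0 ?lee_fin ?sqr_ge0 // (le_trans _ (p1 j)).
(* A nonzero entry of [v] at an infinite exponent makes the right-hand sum [+oo], all other terms
   being nonnegative. Otherwise [v] vanishes at those exponents, and the exponential test functions
   apply. *)
have [[j [pj vj]]|nv] := pselect (exists j, p j = +oo%E /\ v j 0 != 0).
  rewrite (bigD1 j) //= pj gt0_mulye ?lte_fin ?exprn_even_gt0 //.
  rewrite addye ?leey // -ltNye (@lt_le_trans _ _ 0%E) ?ltNy0 //.
  by apply: sume_ge0.
have v0 j : p j = +oo%E -> v j 0 = 0.
  by move=> pj; apply: contra_notP nv => /eqP vj; exists j.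
rewrite (_ : (\sum_(j < m) _)%E = (\sum_(j < m) r j * v j 0 ^+ 2)%:E).
  by rewrite lee_fin -(ler_pM2r (_ : 0 < 2^-1)) ?invr_gt0 // -ler_expR mgf_le.
rewrite -sumEFin; apply: eq_bigr => j _.
have [[pj _]|[pj rj]] := exponentE j; first by rewrite [in LHS]pj EFinM.
by rewrite pj v0 // expr0n /= mule0 mulr0.
Qed.

End characterization.

Theorem mainTheorem6 (R : realType) (m : nat) (S : 'M[R]_m)
    (d : measure_display) (T : measurableType d) (P : probability T R)
    (X : 'I_m -> {RV P >-> R}) (p : 'I_m -> \bar R) :
  psdmx S -> (forall j : 'I_m, S j j = 1) -> centered_gaussian X S ->
  (forall j : 'I_m, (1 <= p j)%E) ->
  hypercontractive X p <-> diag_dominates p S.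
Proof.
move=> _ S1 [k [A [AS AX]]] p1.
have A1 j : \sum_(l < k) A j l ^+ 2 = 1.
  rewrite -(S1 j) -AS mxE; apply: eq_bigr => l _; by rewrite mxE.
rewrite -AS; split=> [hyp|dom f mf bf].
  exact: (hypercontractive_diag_dominates AX A1 p1 hyp).
exact: (expectation_le_prod_Lnorm AX A1 p1 mf bf dom).
Qed.
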